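(* Let $\omega:\mathbb Z\to(0,\infty)$ satisfy $\sup_{n\in\mathbb Z}\frac{\omega(n+1)}{\omega(n)}<\infty$, and let $S_\omega$ be the corresponding bilateral weighted shift on $\ell^2_\omega$. Suppose that $S_\omega$ is power bounded (i.e. $\sup_{k\in\mathbb N}\|S_\omega^k\|<\infty$), $\mathbb T\subset\sigma(S_\omega)$, $\varphi\in H^\infty$, $\liminf_{|z|\to1}|\varphi(z)|=0$ ($z\in\mathbb D$), and $\varphi(S_\omega)$ is invertible. Then $S_\omega$ is similar to the simple bilateral shift.
   Context: $\mathbb D$ is the open unit disc, $\mathbb T$ the unit circle, $\sigma(\cdot)$ denotes the spectrum. For $\omega:\mathbb Z\to(0,\infty)$ with $\sup_{n\in\mathbb Z}\frac{\omega(n+1)}{\omega(n)}<\infty$, $\ell^2_\omega$ is the Hilbert space of complex sequences $u=\{u(n)\}_{n\in\mathbb Z}$ with $\|u\|_\omega^2=\sum_{n\in\mathbb Z}|u(n)|^2\omega(n)^2<\infty$, and $S_\omega$ is the bounded operator on $\ell^2_\omega$ given by $(S_\omega u)(n)=u(n-1)$, $n\in\mathbb Z$. If $\omega\equiv1$, $S_\omega$ is the simple bilateral shift. Two operators $A,B$ are similar if $B=YAY^{-1}$ for some bounded invertible $Y$ with bounded inverse. A power bounded weighted shift $S_\omega$ is similar to a contractive weighted shift, which is an absolutely continuous contraction, i.e. admits an $H^\infty$-functional calculus (the map $p\mapsto p(\cdot)$ on analytic polynomials extends to a bounded algebra homomorphism on $H^\infty$, continuous from the weak-* topology of $H^\infty$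 to the weak-* (ultraweak) topology of operators); $\varphi(S_\omega)$ for $\varphi\in H^\infty$ is defined by this functional calculus (transported via the similarity). *)

(* Defs.v *)
From HB Require Import structures.
From mathcomp Require Import all_boot all_order all_algebra.
From mathcomp Require Import complex ring.
From mathcomp Require Import all_classical all_reals all_analysis.

Set Implicit Arguments.
Unset Strict Implicit.
Unset Printing Implicit Defensive.

Import Order.TTheory GRing.Theory Num.Theory.
Import numFieldNormedType.Exports.

Local Open Scope classical_set_scope.
Local Open Scope ring_scope.

(* The modulus as an element of R (the generic norm of R[i] is R[i]-valued). *)
Notation cabs := Normc.normc.

Section Weights.
Variable R : realType.

Record weight := Weight {
  wt :> int -> R ;
  wt_gt0 : forall n, 0 < wt n ;
  wt_ratio : has_ubound (range (fun n : int => wt (n + 1) / wt n)) }.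

Lemma weight1_gt0 (n : int) : 0 < (fun=> 1 : R) n. Proof. exact: ltr01. Qed.

Lemma weight1_ratio :
  has_ubound (range (fun n : int => (fun=> 1 : R) (n + 1) / (fun=> 1 : R) n)).
Proof. by exists 1 => _ [n _ <-]; rewrite divr1. Qed.

Definition weight1 : weight := Weight weight1_gt0 weight1_ratio.

End Weights.

Section Ell2.
Variables (R : realType) (w : weight R).

Definition sqsum (u : int -> R[i]) : \bar R :=
  \esum_(n in [set: int]) (cabs (u n) ^+ 2 * w n ^+ 2)%:E.

Definition ell2_pred : {pred int -> R[i]} := fun u => `[< (sqsum u < +oo)%E >].

Record ell2 := Ell2 { ell2_val :> int -> R[i] ; _ : ell2_val \in ell2_pred }.

HB.instance Definition _ := [isSub for ell2_val].
HB.instance Definition _ := [Choice of ell2 by <:].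

Lemma ell2P (u : int -> R[i]) : (u \in ell2_pred) = `[< (sqsum u < +oo)%E >].
Proof. by []. Qed.

Lemma sqsum_term_ge0 (u : int -> R[i]) n :
  (0 <= (cabs (u n) ^+ 2 * w n ^+ 2)%:E)%E.
Proof. by rewrite lee_fin mulr_ge0 ?sqr_ge0. Qed.

Lemma esum_le_scale (I : choiceType) (c : R) (a b : I -> R) :
  0 <= c -> (forall i, 0 <= b i) -> (forall i, a i <= c * b i) ->
  (\esum_(i in [set: I]) (a i)%:E <= c%:E * \esum_(i in [set: I]) (b i)%:E)%E.
Proof.
move=> c0 b0 ab; apply: ge_ereal_sup => _ [A [Af _] <-].
apply: (@le_trans _ _ (\sum_(i \in A) (c%:E * (b i)%:E))%E).
  by apply: lee_fsum => // i _; rewrite -EFinM lee_fin.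
rewrite -ge0_mule_fsumr; last by move=> i; rewrite lee_fin.
apply: lee_pmul => //; last first.
  by apply: ereal_sup_ubound; exists A.
by rewrite fsume_ge0// => i _; rewrite lee_fin.
Qed.

Lemma cabs_ge0 (z : R[i]) : 0 <= cabs z.
Proof. by case: z => a b /=; exact: sqrtr_ge0. Qed.

Lemma ell2_submod_closed : submod_closed ell2_pred.
Proof.
split=> [|a u v]; rewrite !ell2P.
  apply/asboolP; rewrite /sqsum esum1 ?ltry// => n _.
  by rewrite Normc.normc0 expr0n mul0r.
move=> /asboolP su /asboolP sv; apply/asboolP.
pose c : R := 2 * cabs a ^+ 2.
have c0 : 0 <= c by rewrite mulr_ge0 ?sqr_ge0.
have key n : cabs ((a *: u + v) n) ^+ 2 * w n ^+ 2 <=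
    c * (cabs (u n) ^+ 2 * w n ^+ 2) + 2 * (cabs (v n) ^+ 2 * w n ^+ 2).
  have {}key : cabs ((a *: u + v) n) ^+ 2 <=
      c * cabs (u n) ^+ 2 + 2 * cabs (v n) ^+ 2.
    apply: (@le_trans _ _ ((cabs a * cabs (u n) + cabs (v n)) ^+ 2)).
      rewrite ler_sqr ?nnegrE ?addr_ge0 ?mulr_ge0 ?cabs_ge0//.
      by rewrite -Normc.normcM; exact: le_normcD.
    rewrite /c -subr_ge0.
    rewrite (_ : _ - _ = (cabs a * cabs (u n) - cabs (v n)) ^+ 2) ?sqr_ge0//.
    by rewrite !expr2; ring.
  rewrite [X in _ <= X + _]mulrA [X in _ <= _ + X]mulrA -mulrDl.
  exact: (ler_wpM2r (sqr_ge0 _) key).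
apply: (@le_lt_trans _ _ (c%:E * sqsum u + 2%:E * sqsum v)%E).
  apply: (@le_trans _ _ (\esum_(n in [set: int])
    ((c * (cabs (u n) ^+ 2 * w n ^+ 2))%:E +
     (2 * (cabs (v n) ^+ 2 * w n ^+ 2))%:E)%E)).
    by apply: le_esum => n _; rewrite -EFinD lee_fin.
  rewrite esumD; first last.
  - by move=> n _; rewrite lee_fin mulr_ge0// mulr_ge0 ?sqr_ge0.
  - by move=> n _; rewrite lee_fin mulr_ge0// mulr_ge0 ?sqr_ge0.
  by apply: leeD; apply: esum_le_scale => // n; rewrite mulr_ge0 ?sqr_ge0.
by rewrite lte_add_pinfty// lte_mul_pinfty// ?lee_fin.
Qed.

HB.instance Definition _ :=
  GRing.isSubmodClosed.Build R[i] (int -> R[i]) ell2_pred ell2_submod_closed.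
HB.instance Definition _ := [SubChoice_isSubLmodule of ell2 by <:].

Definition ell2_norm (u : ell2) : R := Num.sqrt (fine (sqsum u)).

(* Sum of an absolutely convergent family of complex numbers indexed by Z. *)
Definition zsum (f : int -> R[i]) : R[i] :=
  lim ((fun N : nat => \sum_(k < N.*2.+1) f (k%:Z - N%:Z) : R[i]^o) @ \oo).

Definition ell2_inner (u v : ell2) : R[i] :=
  zsum (fun n => u n * (v n)^*%C * ((w n ^+ 2)%:C)%C).

End Ell2.

Section Operators.
Variable R : realType.
Implicit Types w : weight R.

Definition opnorm w1 w2 (A : ell2 w1 -> ell2 w2) : \bar R :=
  ereal_sup [set (ell2_norm (A u))%:E | u in [set u | ell2_norm u <= 1]].

Record bop w1 w2 := Bop {
  bop_fun :> {linear ell2 w1 -> ell2 w2} ;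
  bop_bounded : (opnorm bop_fun < +oo)%E }.

HB.instance Definition _ w1 w2 := gen_eqMixin (bop w1 w2).
HB.instance Definition _ w1 w2 := gen_choiceMixin (bop w1 w2).

Definition op_invertible w1 w2 (A : ell2 w1 -> ell2 w2) : Prop :=
  exists B : bop w2 w1, cancel A B /\ cancel B A.

Definition op_spectrum w (T : bop w w) : set R[i] :=
  [set l | ~ op_invertible (fun u : ell2 w => T u - l *: u)].

Definition op_power_bounded w (T : bop w w) : Prop :=
  (ereal_sup (range (fun k : nat => opnorm (iter k T))) < +oo)%E.

(* B = Y A Y^{-1} with Z = Y^{-1}; the two operators may act on different
   spaces. *)
Definition op_conjugated w1 w2 (Y : bop w1 w2) (Z : bop w2 w1)
    (A : bop w1 w1) (B : bop w2 w2) : Prop :=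
  [/\ cancel Y Z, cancel Z Y & forall v, B v = Y (A (Z v))].

Definition op_similar w1 w2 (A : bop w1 w1) (B : bop w2 w2) : Prop :=
  exists (Y : bop w1 w2) (Z : bop w2 w1), op_conjugated Y Z A B.

End Operators.

Section Shift.
Variables (R : realType) (w : weight R).

Definition shift_seq (u : int -> R[i]) : int -> R[i] := fun n => u (n - 1).

Lemma sqsum_shift : exists2 C : R, 0 <= C &
  forall u, (sqsum w (shift_seq u) <= (C ^+ 2)%:E * sqsum w u)%E.
Proof.
have [C hC] := wt_ratio w.
have wC n : w (n + 1) <= C * w n.
  by rewrite -ler_pdivrMr ?wt_gt0//; apply: hC; exists n.
have C0 : 0 <= C.
  apply: le_trans (hC _ (ex_intro2 _ _ 0 I erefl)).
  by rewrite divr_ge0// ltW// wt_gt0.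
exists C => // u.
rewrite /sqsum (@reindex_esum _ _ _ setT setT (fun n : int => n + 1)); last first.
  split=> [//|n m _ _ /addIr//|n _].
  by exists (n - 1) => //; rewrite subrK.
apply: esum_le_scale => [|n|n]; first exact: sqr_ge0.
  by rewrite mulr_ge0 ?sqr_ge0.
rewrite /shift_seq addrK [leRHS]mulrCA; apply: ler_wpM2l; rewrite ?sqr_ge0// -exprMn.
by rewrite ler_sqr ?nnegrE ?mulr_ge0// ltW// wt_gt0.
Qed.

Lemma shift_seq_ell2 (u : ell2 w) : shift_seq u \in ell2_pred w.
Proof.
rewrite ell2P; apply/asboolP; have [C C0 /(_ u) h] := sqsum_shift.
apply: le_lt_trans h _; rewrite lte_mul_pinfty ?lee_fin ?sqr_ge0//.
by case: u => u /=; rewrite ell2P => /asboolP.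
Qed.

Definition shift_fun (u : ell2 w) : ell2 w := Ell2 (shift_seq_ell2 u).

Lemma shift_fun_is_linear : linear shift_fun.
Proof. by move=> a u v; apply/val_inj; apply/funext => n. Qed.

HB.instance Definition _ :=
  GRing.isLinear.Build R[i] (ell2 w) (ell2 w) *:%R shift_fun shift_fun_is_linear.

Lemma sqsum_ge0 u : (0 <= sqsum w u)%E.
Proof. by apply: esum_ge0 => n _; exact: sqsum_term_ge0. Qed.

Lemma sqsum_fin (u : ell2 w) : sqsum w u \is a fin_num.
Proof.
by rewrite ge0_fin_numE ?sqsum_ge0//; case: u => u /=; rewrite ell2P => /asboolP.
Qed.

Lemma shift_bounded : (opnorm shift_fun < +oo)%E.
Proof.
have [C C0 hC] := sqsum_shift.
apply: (@le_lt_trans _ _ C%:E); last exact: ltry.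
apply: ge_ereal_sup => _ [u /= u1 <-]; rewrite lee_fin.
apply: (@le_trans _ _ (C * ell2_norm u)); last by rewrite ler_piMr.
rewrite /ell2_norm -[in leRHS](ger0_norm C0) -sqrtr_sqr -sqrtrM ?sqr_ge0// ler_wsqrtr//.
by rewrite -lee_fin EFinM !fineK ?sqsum_fin//; exact: hC.
Qed.

Definition wshift : bop w w := Bop shift_bounded.

End Shift.

Section Hinfty.
Variable R : realType.

Definition unit_disc : set R[i] := [set z | cabs z < 1].
Definition unit_circle : set R[i] := [set z | cabs z = 1].

Definition analytic_on_disc (f : R[i] -> R[i]) : Prop :=
  exists a : nat -> R[i], forall z, unit_disc z ->
    (series (fun n => a n * z ^+ n) : nat -> R[i]^o) @ \oo --> (f z : R[i]^o).

(* Only the values on the disc are meaningful: all statements about elements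
   of H^oo below compare them on the disc only. *)
Record Hinf := HInf {
  hinf_fun :> R[i] -> R[i] ;
  hinf_analytic : analytic_on_disc hinf_fun ;
  hinf_bounded : has_ubound [set cabs (hinf_fun z) | z in unit_disc] }.

HB.instance Definition _ := gen_eqMixin Hinf.
HB.instance Definition _ := gen_choiceMixin Hinf.

Definition supnorm (f : Hinf) : R := sup [set cabs (f z) | z in unit_disc].

(* liminf_{|z| -> 1, |z| < 1} |f z| *)
Definition near_circle : set_system R[i] :=
  filter_from [set r : R | r < 1] (fun r => [set z | r < cabs z < 1]).

Definition liminf_circle (f : R[i] -> R[i]) : \bar R :=
  limf_einf (fun z : R[i]^o => (cabs (f z))%:E) near_circle.

Definition expi (t : R) : R[i] := (cos t +i* sin t)%C.

Definition circle_integrable (g : R -> R[i]) : Prop :=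
  lebesgue_measure.-integrable `[0, 2 * pi] (fun t => (complex.Re (g t))%:E) /\
  lebesgue_measure.-integrable `[0, 2 * pi] (fun t => (complex.Im (g t))%:E).

(* integral over the circle with respect to normalised arc length *)
Definition circle_integral (g : R -> R[i]) : R[i] :=
  ((2 * pi)^-1)%:C%C *
  ((\int[lebesgue_measure]_(t in `[0, 2 * pi]) complex.Re (g t)) +i*
   (\int[lebesgue_measure]_(t in `[0, 2 * pi]) complex.Im (g t)))%C.

(* L^1 of the circle, parametrised by the angle in [0, 2 pi] *)
Record L1circle := L1Circle {
  l1_fun :> R -> R[i] ;
  l1_integrable : circle_integrable l1_fun }.

(* The duality between H^oo and L^1 of the circle. By Fatou's theorem and
   dominated convergence, this limit is the integral of g against the boundary
   values of f. *)
Definition wstar_pairing (f : Hinf) : {ptws L1circle -> R[i]^o} :=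
  fun g => lim ((fun r : R =>
    circle_integral (fun t => f (r%:C%C * expi t) * g t) : R[i]^o) @ 1^'-).

Definition Hinf_wstar : Type := initial_topology wstar_pairing.
HB.instance Definition _ := Topological.on Hinf_wstar.

End Hinfty.

Section Ultraweak.
Variables (R : realType) (w : weight R).

Record sqsummable := SqSummable {
  sqs_seq :> nat -> ell2 w ;
  sqs_summable : (\sum_(0 <= k <oo) (ell2_norm (sqs_seq k) ^+ 2)%:E < +oo)%E }.

(* The ultraweakly continuous functionals A |-> sum_k <A x_k, y_k>. *)
Definition uw_pairing (A : bop w w) :
    {ptws (sqsummable * sqsummable)%type -> R[i]^o} :=
  fun xy => lim ((series (fun k => ell2_inner (A (xy.1 k)) (xy.2 k)) :
    nat -> R[i]^o) @ \oo).

Definition bop_ultraweak : Type := initial_topology uw_pairing.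
HB.instance Definition _ := Topological.on bop_ultraweak.

End Ultraweak.

Section Calculus.
Variable R : realType.
Implicit Types w : weight R.

Definition poly_op w (p : {poly R[i]}) (T : bop w w) (u : ell2 w) : ell2 w :=
  \sum_(k < size p) p`_k *: iter k T u.

Record is_Hinf_calculus w (T : bop w w) (Phi : Hinf R -> bop w w) : Prop := {
  calc_poly : forall (p : {poly R[i]}) (f : Hinf R),
    (forall z, unit_disc z -> f z = p.[z]) ->
    forall u, Phi f u = poly_op p T u ;
  calc_linear : forall (a : R[i]) (f g h : Hinf R),
    (forall z, unit_disc z -> h z = a * f z + g z) ->
    forall u, Phi h u = a *: Phi f u + Phi g u ;
  calc_mul : forall f g h : Hinf R,
    (forall z, unit_disc z -> h z = f z * g z) ->
    forall u, Phi h u = Phi f (Phi g u) ;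
  calc_bounded : exists C : R, forall f : Hinf R,
    (opnorm (Phi f) <= (C * supnorm f)%:E)%E ;
  calc_continuous : continuous (Phi : Hinf_wstar R -> bop_ultraweak w) }.

(* A = f(S_w): the calculus of a contractive weighted shift similar to S_w,
   transported along the similarity. *)
Definition is_shift_calculus w (f : Hinf R) (A : bop w w) : Prop :=
  exists (w' : weight R) (Y : bop w' w) (Z : bop w w')
         (Phi : Hinf R -> bop w' w'),
    [/\ (opnorm (wshift w') <= 1)%E,
        op_conjugated Y Z (wshift w') (wshift w),
        is_Hinf_calculus (wshift w') Phi &
        op_conjugated Y Z (Phi f) A].

End Calculus.

(* Main.v *)
Require Import Defs.
From HB Require Import structures.
From mathcomp Require Import all_boot all_order all_algebra.
From mathcomp Require Import cyclic separable cyclotomic complex ring lra zify.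
From mathcomp Require Import all_classical all_reals all_analysis.

Set Implicit Arguments.
Unset Strict Implicit.
Unset Printing Implicit Defensive.

Import Order.TTheory GRing.Theory Num.Theory.
Import numFieldNormedType.Exports.

Local Open Scope classical_set_scope.
Local Open Scope ring_scope.

(** Replacing [w] by the weight [w'] of the contractive shift, we may assume that
    [w] decreases.  For [l] in the disc, [phi z - phi l = (z - l) * g z] with
    [supnorm g <= 8 * supnorm phi / (1 - |l|)], so a unit vector [u] with
    [||S u - l u|| <= e * (1 - |l|)] satisfies [||phi(S) u - phi(l) u|| = O(e)];
    the same holds for approximate eigenvectors of the adjoint.  Once [phi(S)] is
    invertible, [phi] is therefore bounded below at every [l] having such a vector
    with a fixed small [e].

    Suppose that [S] is not similar to the simple shift.  Then [w] drops by
    arbitrarily large factors along suitable intervals, while [1] being in the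
    spectrum yields arbitrarily long intervals where [w] drops at most by the
    factor [2].  If the flat interval precedes the drop, then
    [|l|^-n * w n] has a high peak between them, for [|l|] close to [1], and
    truncating the formal eigenvector [l^-n] to a trapezoid around the peak gives
    an approximate eigenvector of [S].  If the drop comes first, [|l|^n / w n] has
    such a peak, which gives an approximate eigenvector of the adjoint.  Hence
    [|phi|] is bounded below near the circle. *)

(** * The complex modulus, and series dominated by a geometric one *)

Section ComplexSequences.
Variable R : realType.
Implicit Types (z : R[i]) (u : nat -> R[i]).

Lemma cabs_norm z : `|z| = (cabs z)%:C%C. Proof. by []. Qed.

Lemma cabsD z1 z2 : cabs (z1 + z2) <= cabs z1 + cabs z2.
Proof. exact: le_normcD. Qed.

Lemma cabsN z : cabs (- z) = cabs z.
Proof. exact: normcN. Qed.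

Lemma cabsB z1 z2 : cabs (z1 - z2) = cabs (z2 - z1).
Proof. by rewrite -cabsN opprB. Qed.

Lemma cabs_distD z1 z2 z3 : cabs (z1 - z3) <= cabs (z1 - z2) + cabs (z2 - z3).
Proof. by rewrite -[z1 - z3](subrKA z2); exact: cabsD. Qed.

Lemma cabsM z1 z2 : cabs (z1 * z2) = cabs z1 * cabs z2.
Proof. exact: Normc.normcM. Qed.

Lemma cabsX z n : cabs (z ^+ n) = cabs z ^+ n.
Proof.
by elim: n => [|n ih]; rewrite ?Normc.normc1// !exprS cabsM ih.
Qed.

Lemma cabs_eq0 z : (cabs z == 0) = (z == 0).
Proof.
by apply/eqP/eqP => [/Normc.eq0_normc//|->]; exact: Normc.normc0.
Qed.

Lemma cabs_gt0 z : (0 < cabs z) = (z != 0).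
Proof. by rewrite lt0r cabs_ge0 andbT cabs_eq0. Qed.

Lemma cabs_real (x : R) : cabs x%:C%C = `|x|.
Proof. by rewrite /= expr0n addr0 sqrtr_sqr. Qed.

Lemma cabs_sum (I : Type) (r : seq I) (P : pred I) (F : I -> R[i]) :
  cabs (\sum_(i <- r | P i) F i) <= \sum_(i <- r | P i) cabs (F i).
Proof.
elim/big_ind2 : _ => [|x1 x2 y1 y2 h1 h2|//]; first by rewrite Normc.normc0.
by apply: (le_trans (cabsD _ _)); exact: lerD.
Qed.

Lemma cabs_dist z1 z2 : cabs z1 - cabs z2 <= cabs (z1 - z2).
Proof. by rewrite lerBlDr; apply: le_trans (cabsD _ _); rewrite subrK. Qed.

Lemma Re_le_cabs z : `|complex.Re z| <= cabs z.
Proof. by rewrite -lecR; exact: normc_ge_Re. Qed.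

Lemma Im_le_cabs z : `|complex.Im z| <= cabs z.
Proof.
by case: z => a b /=; rewrite -sqrtr_sqr ler_wsqrtr// lerDr sqr_ge0.
Qed.

Lemma cabs_le_ReIm z : cabs z <= `|complex.Re z| + `|complex.Im z|.
Proof.
case: z => a b /=; rewrite -[leRHS]ger0_norm ?addr_ge0// -sqrtr_sqr ler_wsqrtr//.
rewrite -(real_normK (num_real a)) -(real_normK (num_real b)).
by rewrite sqrrD lerD2r lerDl mulrn_wge0// mulr_ge0.
Qed.

Lemma complex_cvgP u z :
  ((u : nat -> R[i]^o) @ \oo --> (z : R[i]^o)) <->
  forall e : R, 0 < e -> exists N, forall n, (N <= n)%N -> cabs (z - u n) < e.
Proof.
split=> [/cvgrPdist_lt h e e0|h].
  have /h[N _ hN] : 0 < e%:C%C :> R[i] by rewrite ltcR.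
  exists N => n Nn; have := hN n Nn.
  by rewrite /= -ltcR; apply.
apply/cvgrPdist_lt => e e0.
(* The norm of [R[i]] is [R[i]]-valued, so [e] is complex; its positivity forces a zero imaginary
   part. *)
have [e' e'E] : exists e' : R, e = e'%:C%C.
  by move: (e0); rewrite ltcE => /andP[/eqP /= + _]; case: (e) => a b /= ->; exists a.
move: e0; rewrite e'E ltcR => /h[N hN]; exists N => // n /hN /=.
by rewrite -ltcR.
Qed.

Lemma complex_cvg_unique u z1 z2 :
  ((u : nat -> R[i]^o) @ \oo --> (z1 : R[i]^o)) ->
  ((u : nat -> R[i]^o) @ \oo --> (z2 : R[i]^o)) -> z1 = z2.
Proof. exact: (@cvg_unique _ (@norm_hausdorff _ R[i]^o)). Qed.

Lemma geometric_lt (a r e : R) : 0 <= r < 1 -> 0 < e ->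
  exists N, forall n, (N <= n)%N -> a * r ^+ n < e.
Proof.
move=> /andP[r0 r1] e0.
have : geometric a r @ \oo --> 0.
  by apply: cvg_geometric; rewrite ger0_norm.
move=> /cvgrPdist_lt/(_ _ e0)[N _ hN]; exists N => n Nn.
by have := hN n Nn; rewrite /= sub0r normrN; apply: le_lt_trans (ler_norm _).
Qed.

Lemma geometric_sum_le (r : R) m n : 0 <= r < 1 ->
  \sum_(m <= k < n) r ^+ k <= r ^+ m / (1 - r).
Proof.
move=> /andP[r0 r1]; rewrite ler_pdivlMr ?subr_gt0//.
have [mn|nm] := leqP m n; last first.
  by rewrite big_geq ?mul0r ?exprn_ge0// ltnW.
suff -> : (\sum_(m <= k < n) r ^+ k) * (1 - r) = r ^+ m - r ^+ n.
  by rewrite lerBlDr lerDl exprn_ge0.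
rewrite mulr_suml (telescope_sumr_eq (fun k => - r ^+ k) _ mn).
  by rewrite opprK addrC.
by move=> k _; rewrite exprS; ring.
Qed.

Lemma series_tail_le (c : nat -> R[i]) (A r : R) m n : 0 <= r < 1 -> 0 <= A ->
  (forall k, cabs (c k) <= A * r ^+ k) -> (m <= n)%N ->
  cabs (series c n - series c m) <= A * r ^+ m / (1 - r).
Proof.
move=> r01 A0 hc mn; rewrite !seriesEnat /= (big_cat_nat (leq0n m) mn)//=.
rewrite addrAC subrr add0r; apply: le_trans (cabs_sum _ _ _) _.
apply: (@le_trans _ _ (\sum_(m <= k < n) A * r ^+ k)).
  by apply: ler_sum => k _; exact: hc.
by rewrite -mulr_sumr -mulrA ler_wpM2l// geometric_sum_le.
Qed.

Lemma series_geometric_cvg (c : nat -> R[i]) (A r : R) : 0 <= r < 1 -> 0 <= A ->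
  (forall k, cabs (c k) <= A * r ^+ k) ->
  exists l : R[i], (series c : nat -> R[i]^o) @ \oo --> (l : R[i]^o).
Proof.
move=> r01 A0 hc.
have real_cvg (d : nat -> R) : (forall k, `|d k| <= A * r ^+ k) ->
    cvgn (series d).
  move=> hd; apply: normed_cvg.
  apply: (@series_le_cvg _ _ (geometric A r)) => [k|k|k|] /=.
  - exact: normr_ge0.
  - by rewrite mulr_ge0// exprn_ge0//; case/andP: r01.
  - exact: hd.
  apply: is_cvg_geometric_series.
  by case/andP: r01 => r0 r1; rewrite ger0_norm.
have hre : cvgn (series (fun k => complex.Re (c k))).
  by apply: real_cvg => k; apply: le_trans (Re_le_cabs _) (hc k).
have him : cvgn (series (fun k => complex.Im (c k))).
  by apply: real_cvg => k; apply: le_trans (Im_le_cabs _) (hc k).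
set lr := limn _ in hre; set li := limn _ in him.
exists (lr +i* li)%C; apply/complex_cvgP => e e0.
have e20 : 0 < e / 2 by rewrite divr_gt0.
move/cvgrPdist_lt/(_ _ e20) : hre => [N1 _ h1].
move/cvgrPdist_lt/(_ _ e20) : him => [N2 _ h2].
exists (maxn N1 N2) => n; rewrite geq_max => /andP[n1 n2].
apply: le_lt_trans (cabs_le_ReIm _) _.
have -> : e = e / 2 + e / 2 by field.
have seriesE (f : R[i] -> R) : (forall x y, f (x + y) = f x + f y) -> f 0 = 0 ->
    f (series c n) = series (fun k => f (c k)) n.
  by move=> fD f0; rewrite !seriesEnat /= (big_morph f fD f0).
rewrite !raddfB /= (seriesE (@complex.Re R)) ?(seriesE (@complex.Im R))//;
  try by case=> ? ? [].
by apply: ltrD; [exact: h1|exact: h2].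
Qed.

Lemma series_limit_tail_le (c : nat -> R[i]) (A r : R) (l : R[i]) m :
  0 <= r < 1 -> 0 <= A ->
  (forall k, cabs (c k) <= A * r ^+ k) ->
  (series c : nat -> R[i]^o) @ \oo --> (l : R[i]^o) ->
  cabs (l - series c m) <= A * r ^+ m / (1 - r).
Proof.
move=> r01 A0 hc /complex_cvgP hl; apply/ler_addgt0Pr => e /hl[N hN].
have /hN/ltW h1 := leq_maxr m N.
apply: le_trans (cabs_distD _ (series c (maxn m N)) _) _.
by rewrite addrC lerD// (series_tail_le r01)// leq_maxl.
Qed.

End ComplexSequences.

(** * Power series on the disc *)

Section PowerSeries.
Variable R : realType.
Implicit Types (a b : nat -> R[i]) (f : R[i] -> R[i]) (x z l : R[i]).

Definition power_series_cvg a z l :=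
  (series (fun n => a n * z ^+ n) : nat -> R[i]^o) @ \oo --> (l : R[i]^o).

Lemma power_series_coef_le a z l : power_series_cvg a z l ->
  exists2 A, 0 <= A & forall n, cabs (a n) * cabs z ^+ n <= A.
Proof.
move=> /complex_cvgP/(_ _ ltr01)[N hN].
(* From [N] on, a term is the difference of two partial sums within 1 of [l], hence at most 2; the
   finite sum takes care of the earlier terms. *)
exists (2 + \sum_(k < N) cabs (a k) * cabs z ^+ k).
  by rewrite addr_ge0// sumr_ge0// => k _; rewrite mulr_ge0 ?exprn_ge0 ?cabs_ge0.
move=> n; have [nN|Nn] := ltnP n N.
  rewrite (bigD1 (Ordinal nN))//= addrCA lerDl addr_ge0// sumr_ge0// => k _.
  by rewrite mulr_ge0 ?exprn_ge0 ?cabs_ge0.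
apply: ler_wpDr.
  by rewrite sumr_ge0// => k _; rewrite mulr_ge0 ?exprn_ge0 ?cabs_ge0.
rewrite -cabsX -cabsM.
have -> : a n * z ^+ n =
    series (fun k => a k * z ^+ k) n.+1 - series (fun k => a k * z ^+ k) n.
  by rewrite !seriesEnat /= big_nat_recr//= addrAC subrr add0r.
apply: le_trans (cabs_distD _ l _) _.
have := ltW (hN n Nn); have := ltW (hN n.+1 (leqW Nn)); rewrite cabsB; lra.
Qed.

(** Turns a coefficient bound at radius [r] into geometric decay of ratio [t / r] at radius [t]. *)
Lemma geometric_term_le (c t r : R) (A : R) n : 0 < r ->
  c * r ^+ n <= A -> 0 <= t -> c * t ^+ n <= A * (t / r) ^+ n.
Proof.
move=> r0 h t0; rewrite expr_div_n mulrA ler_pdivlMr ?exprn_gt0//.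
by rewrite mulrAC ler_wpM2r// exprn_ge0.
Qed.

(** [X^n - 1] splits over [R[i]] and is separable in characteristic 0, so it has [n] distinct roots,
    one of which must be primitive. *)
Lemma prim_root_exists n : (0 < n)%N -> exists x : R[i], n.-primitive_root x.
Proof.
move=> n0; have [rs] := closed_field_poly_normal ('X^n - 1 : {poly R[i]}).
rewrite (monicP (monicXnsubC _ n0)) scale1r => rsE.
have rsU : uniq rs.
  by rewrite -separable_prod_XsubC -rsE separable_Xn_sub_1// pnatr_eq0 -lt0n.
have rs1 : all n.-unity_root rs.
  by apply/allP => x; rewrite -root_prod_XsubC -rsE.
have rsn : (n <= size rs)%N.
  by rewrite -ltnS -(size_prod_XsubC rs id) -rsE size_XnsubC.
by have /hasP[x _ hx] := has_prim_root n0 rs1 rsU rsn; exists x.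
Qed.

Lemma prim_root_cabs n x : n.-primitive_root x -> cabs x = 1.
Proof.
move=> hx; have n0 := prim_order_gt0 hx.
apply/eqP; rewrite -(@pexpr_eq1 _ _ n) ?cabs_ge0// -cabsX prim_expr_order//.
by rewrite Normc.normc1.
Qed.

Lemma prim_root_sum_expr n x k : n.-primitive_root x -> (0 < k < n)%N ->
  \sum_(j < n) (x ^+ j) ^+ k = 0.
Proof.
move=> hx /andP[k0 kn].
have xk1 : x ^+ k - 1 != 0.
  by rewrite subr_eq0 -(prim_order_dvd hx) gtnNdvd.
apply: (mulfI xk1); rewrite mulr0.
under eq_bigr do rewrite -exprM mulnC exprM.
by rewrite -subrX1 exprAC (prim_expr_order hx) expr1n subrr.
Qed.

(** Discrete mean value property: in the binomial expansion only the term free of [y] survives,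
    because the [i]-th powers of the roots of unity sum to zero for [0 < i < n]. *)
Lemma prim_root_mean_expr n x z (y : R[i]) k : n.-primitive_root x -> (k < n)%N ->
  \sum_(j < n) (z + y * x ^+ j) ^+ k = n%:R * z ^+ k.
Proof.
move=> hx kn; under eq_bigr do rewrite exprDn.
rewrite exchange_big big_ord_recl /= [X in _ + X]big1 ?addr0.
  under eq_bigr do rewrite expr0 mulr1 subn0 bin0 mulr1n.
  by rewrite sumr_const card_ord mulr_natl.
move=> i _; rewrite sumrMnl -mulr_sumr.
under eq_bigr do rewrite exprMn.
rewrite -mulr_sumr prim_root_sum_expr// ?mulr0 ?mul0rn//.
by rewrite /= /bump /= add1n; move: (ltn_ord i); lia.
Qed.

(* The average over the [n]-th roots of unity is exact on the partial sum of order [n]. *)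
Lemma power_series_mean_le b f (A s B r : R) z : 0 <= A -> 0 < s ->
  (forall n, cabs (b n) * s ^+ n <= A) ->
  (forall x, cabs x < s -> power_series_cvg b x (f x)) ->
  0 <= r -> cabs z + r < s ->
  (forall x, cabs (x - z) = r -> cabs (f x) <= B) -> cabs (f z) <= B.
Proof.
move=> A0 s0 hb hf r0 zrs hB.
pose t := (cabs z + r) / s.
have t01 : 0 <= t < 1.
  by rewrite /t ltr_pdivrMr// mul1r zrs andbT divr_ge0 ?addr_ge0 ?cabs_ge0// ltW.
have tail x n : cabs x <= cabs z + r ->
    cabs (f x - series (fun k => b k * x ^+ k) n) <= A * t ^+ n / (1 - t).
  move=> xz; apply: series_limit_tail_le => //; last first.
    by apply: hf; apply: le_lt_trans xz _.
  move=> k; rewrite cabsM cabsX; apply: (@le_trans _ _ (cabs (b k) * (cabs z + r) ^+ k)).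
    by rewrite ler_wpM2l ?cabs_ge0// lerXn2r ?nnegrE ?cabs_ge0 ?addr_ge0 ?cabs_ge0.
  by apply: geometric_term_le; rewrite ?addr_ge0 ?cabs_ge0.
apply/ler_addgt0Pr => e e0.
(* The tail is paid twice, once on the circle and once at [z], hence the factor 2. Taking [n = N.+1]
   keeps [n] positive, so that one can divide by it. *)
have [N hN] := geometric_lt (2 * A / (1 - t)) t01 e0.
have {hN} := hN N.+1 (leqnSn N); set n := N.+1; set E := A * t ^+ n / (1 - t).
have -> : 2 * A / (1 - t) * t ^+ n = 2 * E by rewrite /E; ring.
move=> hE; have [x hx] := @prim_root_exists n isT.
pose y j := z + r%:C%C * x ^+ j.
have yz j : cabs (y j - z) = r.
  rewrite /y addrAC subrr add0r cabsM cabsX (prim_root_cabs hx) expr1n mulr1.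
  by rewrite cabs_real ger0_norm.
pose P x := series (fun k => b k * x ^+ k) n.
have meanP : \sum_(j < n) P (y j) = n%:R * P z.
  rewrite /P !seriesEnat /= exchange_big /= mulr_sumr big_seq [RHS]big_seq.
  apply: eq_bigr => k; rewrite mem_index_iota => /= kn.
  by rewrite -mulr_sumr (prim_root_mean_expr _ _ hx)// mulrCA.
have hPy j : cabs (P (y j)) <= B + E.
  have hyj : cabs (y j) <= cabs z + r.
    by rewrite -[y j](subrK z) addrC (le_trans (cabsD _ _))// yz.
  have := tail _ n hyj; rewrite -/(P _) -/E => h1.
  have h2 := hB _ (yz j).
  by rewrite -[P _](subrKC (f (y j))) (le_trans (cabsD _ _))// lerD// cabsB.
have hPz : cabs (P z) <= B + E.
  have n0 : 0 < n%:R :> R by rewrite ltr0n.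
  rewrite -(ler_pM2l n0) -[n%:R in leLHS]ger0_norm ?ler0n//.
  rewrite -cabs_real -cabsM rmorph_nat -meanP (le_trans (cabs_sum _ _ _))//.
  apply: (@le_trans _ _ (\sum_(j < n) (B + E))).
    by apply: ler_sum => j _; exact: hPy.
  by rewrite sumr_const card_ord mulr_natl.
have := tail z n; rewrite lerDl -/(P z) -/E => /(_ r0) hz.
have := cabsD (f z - P z) (P z); rewrite subrK; lra.
Qed.

End PowerSeries.

(** * Constructions in H^oo and division by [z - l] *)

Section HinfOperations.
Variable R : realType.
Implicit Types (f g h : Hinf R) (z l c : R[i]) (p : {poly R[i]}).

Lemma supnorm_ge f z : unit_disc z -> cabs (f z) <= supnorm f.
Proof. by move=> hz; apply: ub_le_sup; [exact: hinf_bounded|exists z]. Qed.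

Lemma unit_disc0 : unit_disc (0 : R[i]).
Proof. by have : cabs (0 : R[i]) < 1 by rewrite Normc.normc0. Qed.

Lemma supnorm_ge0 f : 0 <= supnorm f.
Proof. exact: le_trans (cabs_ge0 _) (supnorm_ge f unit_disc0). Qed.

Lemma supnorm_le f (B : R) :
  (forall z, unit_disc z -> cabs (f z) <= B) -> supnorm f <= B.
Proof.
move=> h; apply: ge_sup; first by exists (cabs (f 0)); exists 0 => //; exact: unit_disc0.
by move=> _ [z hz <-]; exact: h.
Qed.

Lemma hinf_poly_exists p : exists f, forall z, f z = p.[z].
Proof.
have ha : analytic_on_disc (fun z => p.[z]).
  exists (fun n => p`_n) => z _; apply/complex_cvgP => e e0.
  exists (size p) => n pn; rewrite seriesEnat /= (horner_coef_wide _ pn).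
  by rewrite big_mkord subrr Normc.normc0.
have hb : has_ubound [set cabs p.[z] | z in @unit_disc R].
  exists (\sum_(k < size p) cabs p`_k) => _ [z hz <-].
  rewrite horner_coef (le_trans (cabs_sum _ _ _))//; apply: ler_sum => k _.
  rewrite cabsM cabsX ler_piMr ?cabs_ge0// exprn_ile1 ?cabs_ge0//.
  exact: ltW.
by exists (HInf ha hb).
Qed.

Lemma hinf_lin_exists c f g : exists h, forall z, h z = c * f z + g z.
Proof.
have ha : analytic_on_disc (fun z => c * f z + g z).
  have [a ha] := hinf_analytic f; have [b hb] := hinf_analytic g.
  exists (fun n => c * a n + b n) => z hz.
  have -> : series (fun n => (c * a n + b n) * z ^+ n) =
      (fun n => c * series (fun n => a n * z ^+ n) n + series (fun n => b n * z ^+ n) n).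
    apply/funext => n; rewrite !seriesEnat /= mulr_sumr -big_split /=.
    by apply: eq_bigr => k _; rewrite mulrDl mulrA.
  by apply: (@cvgD _ R[i]^o); [apply: cvgMl_tmp; exact: ha|exact: hb].
have hb : has_ubound [set cabs (c * f z + g z) | z in @unit_disc R].
  exists (cabs c * supnorm f + supnorm g) => _ [z hz <-].
  rewrite (le_trans (cabsD _ _))// cabsM lerD ?supnorm_ge//.
  by rewrite ler_wpM2l ?cabs_ge0 ?supnorm_ge.
by exists (HInf ha hb).
Qed.

Section Quotient.
Variables (f : Hinf R) (l : R[i]) (a : nat -> R[i]).
Hypotheses (l0 : l != 0) (l1 : unit_disc l).
Hypothesis hf : forall z, unit_disc z -> power_series_cvg a z (f z).

Let rest n := f l - series (fun k => a k * l ^+ k) n.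

(* Power series division of [f z - f l] by [z - l]. *)
Let b n := rest n.+1 / l ^+ n.+1.

(** The division identity, exact at the level of partial sums; its error [rest n * (z / l) ^+ n]
    tends to zero for [z] in the disc. *)
Let quotient_partial z n : (z - l) * series (fun k => b k * z ^+ k) n =
  series (fun k => a k * z ^+ k) n - f l + rest n * (z / l) ^+ n.
Proof.
elim: n => [|n ih].
  by rewrite /rest !seriesEnat /= !big_geq// mulr0 sub0r subr0 expr0 mulr1 addNr.
have restS : rest n = rest n.+1 + a n * l ^+ n.
  by rewrite /rest !seriesEnat /= big_nat_recr//= opprD addrA subrK.
move: ih; rewrite !seriesEnat /= !big_nat_recr//= mulrDr => ->.
rewrite restS /b !expr_div_n !exprS; field.
by rewrite expf_neq0.
Qed.

(** The coefficients [a k] are [O(s^-k)], so the tail at [l] is [O((|l| / s)^n)], and dividing it by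
    [|l|^n] leaves [O(s^-n)]. *)
Let rest_le (s : R) : cabs l < s -> s < 1 ->
  exists2 A, 0 <= A & forall n, cabs (rest n) / cabs l ^+ n * s ^+ n <= A.
Proof.
move=> ls s1; have s0 : 0 < s by apply: le_lt_trans ls; exact: cabs_ge0.
have sE : cabs s%:C%C = s by rewrite cabs_real gtr0_norm.
have [|A A0 hA] := power_series_coef_le (hf (z := s%:C%C) _).
  by have : cabs s%:C%C < 1 by rewrite sE.
rewrite sE in hA.
have t01 : 0 <= cabs l / s < 1.
  by rewrite ltr_pdivrMr// mul1r ls andbT divr_ge0 ?cabs_ge0// ltW.
exists (A / (1 - cabs l / s)).
  by rewrite divr_ge0// subr_ge0 ltW//; case/andP: t01.
move=> n; have lp : 0 < cabs l by rewrite cabs_gt0.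
have := @series_limit_tail_le _ (fun k => a k * l ^+ k) A (cabs l / s) (f l) n t01 A0.
have h1 k : cabs (a k * l ^+ k) <= A * (cabs l / s) ^+ k.
  by rewrite cabsM cabsX; apply: geometric_term_le; rewrite ?cabs_ge0.
move=> /(_ h1 (hf l1)) => h2.
rewrite -mulrA mulrC -ler_pdivlMl; last first.
  by rewrite mulr_gt0 ?invr_gt0 ?exprn_gt0.
rewrite (le_trans h2)// expr_div_n invfM invrK le_eqVlt; apply/orP; left; apply/eqP.
by ring.
Qed.

Let b_le (s : R) : cabs l < s -> s < 1 ->
  exists2 A, 0 <= A & forall n, cabs (b n) * s ^+ n <= A.
Proof.
move=> ls s1; have s0 : 0 < s by apply: le_lt_trans ls; exact: cabs_ge0.
have [A A0 hA] := rest_le ls s1; exists (A / s); first by rewrite divr_ge0// ltW.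
move=> n; rewrite ler_pdivlMr// -mulrA -exprSr.
by rewrite /b cabsM Normc.normcV cabsX; exact: hA.
Qed.

Let between z : unit_disc z -> exists2 s, cabs l < s < 1 & cabs z < s < 1.
Proof.
move=> z1; have z1' : cabs z < 1 by []; have l1' : cabs l < 1 by [].
by exists ((1 + Num.max (cabs l) (cabs z)) / 2); case: (leP (cabs l) (cabs z)) => h;
  apply/andP; split; lra.
Qed.

Let quotient z : R[i] := lim ((series (fun k => b k * z ^+ k) : nat -> R[i]^o) @ \oo).

Let quotient_cvg z : unit_disc z -> power_series_cvg b z (quotient z).
Proof.
move=> /between[s /andP[ls s1] /andP[zs _]].
have s0 : 0 < s by apply: le_lt_trans ls; exact: cabs_ge0.
have [A A0 hA] := b_le ls s1.
have [||k|c hc] := @series_geometric_cvg _ (fun k => b k * z ^+ k) A (cabs z / s).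
- by rewrite ltr_pdivrMr// mul1r zs andbT divr_ge0 ?cabs_ge0// ltW.
- by [].
- by rewrite cabsM cabsX; apply: geometric_term_le; rewrite ?cabs_ge0.
by rewrite /power_series_cvg /quotient; apply: cvgP hc.
Qed.

Let quotientE z : unit_disc z -> (z - l) * quotient z = f z - f l.
Proof.
move=> hz; have [s /andP[ls s1] /andP[zs _]] := between hz.
have s0 : 0 < s by apply: le_lt_trans ls; exact: cabs_ge0.
have [A A0 hA] := rest_le ls s1.
apply: (@complex_cvg_unique _ (fun n => (z - l) * series (fun k => b k * z ^+ k) n)).
  by apply: cvgMl_tmp; exact: quotient_cvg.
rewrite (funext (quotient_partial z)) -[f z - f l]addr0.
apply: (@cvgD _ R[i]^o).
  by apply: (@cvgB _ R[i]^o); [exact: hf|exact: cvg_cst].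
apply/complex_cvgP => e e0.
have t01 : 0 <= cabs z / s < 1.
  by rewrite ltr_pdivrMr// mul1r zs andbT divr_ge0 ?cabs_ge0// ltW.
have [N hN] := geometric_lt A t01 e0; exists N => n /hN; apply: le_lt_trans.
rewrite sub0r cabsN cabsM cabsX cabsM Normc.normcV expr_div_n [X in _ * X]mulrC mulrA.
by apply: geometric_term_le; rewrite ?cabs_ge0.
Qed.

(** Put [t = 1 - |l|]. At distance at least [t / 4] from [l], dividing
    [|f z - f l| <= 2 * supnorm f] by [|z - l|] gives the bound. A closer [z] is the centre of a
    circle of radius [t / 2] that stays in the disc and at distance at least [t / 4] from [l], so
    the mean value inequality carries the bound over to [z]. *)
Lemma hinf_quotient_of_series : exists g,
  (forall z, unit_disc z -> (z - l) * g z = f z - f l) /\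
  forall z, unit_disc z -> cabs (g z) <= 8 * supnorm f / (1 - cabs l).
Proof.
have l1' : cabs l < 1 by [].
pose t := 1 - cabs l; have t0 : 0 < t by rewrite subr_gt0.
have far z : unit_disc z -> t / 4 <= cabs (z - l) ->
    cabs (quotient z) <= 8 * supnorm f / t.
  move=> hz zl.
  have zl0 : 0 < cabs (z - l) by apply: lt_le_trans zl; rewrite divr_gt0.
  have : cabs ((z - l) * quotient z) <= 2 * supnorm f.
    rewrite quotientE// (le_trans (cabsD _ _))// cabsN.
    by have := supnorm_ge f hz; have := supnorm_ge f l1; lra.
  rewrite cabsM ler_pdivlMr// => h.
  have := ler_wpM2r (cabs_ge0 (quotient z)) zl; lra.
have bound z : unit_disc z -> cabs (quotient z) <= 8 * supnorm f / t.
  move=> hz; have [/far|zl] := leP (t / 4) (cabs (z - l)); first exact.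
  have zl' : cabs z < cabs l + t / 4 by have := cabs_dist z l; lra.
  (* Since [|z| + t / 2 < |l| + 3 t / 4 < s < 1], the circle around [z] lies inside the disc of
     radius [s]. *)
  pose s := cabs l + 7 / 8 * t.
  have ls : cabs l < s by rewrite /s; lra.
  have s1 : s < 1 by rewrite /s /t; lra.
  have [A A0 hA] := b_le ls s1.
  have s0 : 0 < s by apply: le_lt_trans ls; exact: cabs_ge0.
  apply: (@power_series_mean_le _ b quotient A s _ (t / 2) z) => //.
  - move=> x xs; apply: quotient_cvg; exact: lt_trans xs s1.
  - by rewrite divr_ge0// ltW.
  - by rewrite /s; lra.
  move=> x xz; apply: far.
    have : cabs x < 1 by have := cabs_dist x z; rewrite xz; move: zl' t0; rewrite /t; lra.
    by [].
  by have := cabs_distD x l z; rewrite xz [cabs (l - z)]cabsB; lra.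
have ha : analytic_on_disc quotient by exists b => z; exact: quotient_cvg.
have hb : has_ubound [set cabs (quotient z) | z in @unit_disc R].
  by exists (8 * supnorm f / t) => _ [z hz <-]; exact: bound.
by exists (HInf ha hb).
Qed.

End Quotient.

Lemma hinf_quotient_exists f l : l != 0 -> unit_disc l -> exists g,
  (forall z, unit_disc z -> (z - l) * g z = f z - f l) /\
  supnorm g <= 8 * supnorm f / (1 - cabs l).
Proof.
move=> l0 l1; have [a ha] := hinf_analytic f.
have [g [gE gle]] := hinf_quotient_of_series l0 l1 ha.
by exists g; split=> //; exact: supnorm_le.
Qed.

End HinfOperations.

(** * The norm of weighted l^2 *)

Section Ell2Norm.
Variables (R : realType) (w : weight R).
Implicit Types (u v : ell2 w) (a : R[i]).

Lemma ell2_norm_ge0 u : 0 <= ell2_norm u.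
Proof. exact: sqrtr_ge0. Qed.

Lemma ell2_norm_sqr u : (ell2_norm u ^+ 2)%:E = sqsum w u.
Proof.
by rewrite /ell2_norm sqr_sqrtr ?fine_ge0 ?sqsum_ge0// fineK// sqsum_fin.
Qed.

Lemma ell2_norm_le u (B : R) : 0 <= B ->
  (sqsum w u <= (B ^+ 2)%:E)%E -> ell2_norm u <= B.
Proof. by move=> B0; rewrite -ell2_norm_sqr lee_fin ler_sqr ?nnegrE ?ell2_norm_ge0. Qed.

Lemma ell2_coord_le u n : cabs (u n) * w n <= ell2_norm u.
Proof.
have wn := ltW (wt_gt0 w n).
rewrite -ler_sqr ?nnegrE ?ell2_norm_ge0 ?mulr_ge0 ?cabs_ge0// exprMn -lee_fin.
rewrite ell2_norm_sqr; apply: esum_ge.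
by exists [set n]; [split|rewrite fsbig_set1].
Qed.

Lemma ell2_norm_eq0 u : ell2_norm u = 0 -> u = 0.
Proof.
move=> h; apply/val_inj/funext => n; apply: Normc.eq0_normc; apply/eqP.
have := ell2_coord_le u n; rewrite h pmulr_lle0 ?wt_gt0// => h1.
by rewrite eq_le h1 cabs_ge0.
Qed.

Lemma ell2_norm0 : ell2_norm (0 : ell2 w) = 0.
Proof.
apply/eqP; rewrite eq_le ell2_norm_ge0 andbT ell2_norm_le// expr0n /=.
by rewrite /sqsum esum1// => n _; rewrite Normc.normc0 expr0n mul0r.
Qed.

Lemma ell2_normZ_le a u : ell2_norm (a *: u) <= cabs a * ell2_norm u.
Proof.
apply: ell2_norm_le; first by rewrite mulr_ge0 ?cabs_ge0 ?ell2_norm_ge0.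
rewrite exprMn EFinM ell2_norm_sqr; apply: esum_le_scale => [|n|n].
- exact: sqr_ge0.
- by rewrite mulr_ge0 ?sqr_ge0.
by rewrite cabsM exprMn -mulrA.
Qed.

Lemma ell2_normN u : ell2_norm (- u) = ell2_norm u.
Proof.
rewrite /ell2_norm; congr (Num.sqrt (fine _)).
by apply: eq_esum => n _; rewrite cabsN.
Qed.

(* [(x + y)^2 <= (1 + t) x^2 + (1 + 1/t) y^2], optimised at [t = ||v|| / ||u||]. *)
Lemma ell2_normD u v : ell2_norm (u + v) <= ell2_norm u + ell2_norm v.
Proof.
have [/ell2_norm_eq0 ->|u0] := eqVneq (ell2_norm u) 0.
  by rewrite add0r lerDr ell2_norm_ge0.
have [/ell2_norm_eq0 ->|v0] := eqVneq (ell2_norm v) 0.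
  by rewrite addr0 lerDl ell2_norm_ge0.
have {u0} up : 0 < ell2_norm u by rewrite lt0r u0 ell2_norm_ge0.
have {v0} vp : 0 < ell2_norm v by rewrite lt0r v0 ell2_norm_ge0.
apply: ell2_norm_le; first by rewrite addr_ge0 ?ell2_norm_ge0.
pose t := ell2_norm v / ell2_norm u.
have t0 : 0 < t by rewrite divr_gt0.
have -> : (ell2_norm u + ell2_norm v) ^+ 2 =
    (1 + t) * ell2_norm u ^+ 2 + (1 + t^-1) * ell2_norm v ^+ 2.
  by rewrite /t; field; rewrite ?gt_eqF.
rewrite EFinD EFinM ell2_norm_sqr EFinM ell2_norm_sqr.
apply: (@le_trans _ _ (\esum_(n in [set: int])
    (((1 + t) * (cabs (u n) ^+ 2 * w n ^+ 2))%:E +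
     ((1 + t^-1) * (cabs (v n) ^+ 2 * w n ^+ 2))%:E)%E)).
  apply: le_esum => n _; rewrite -EFinD lee_fin.
  rewrite [X in _ <= X + _]mulrA [X in _ <= _ + X]mulrA -mulrDl.
  apply: ler_wpM2r; first exact: sqr_ge0.
  apply: (@le_trans _ _ ((cabs (u n) + cabs (v n)) ^+ 2)).
    by rewrite ler_sqr ?nnegrE ?addr_ge0 ?cabs_ge0// cabsD.
  rewrite -subr_ge0.
  have -> : (1 + t) * cabs (u n) ^+ 2 + (1 + t^-1) * cabs (v n) ^+ 2 -
      (cabs (u n) + cabs (v n)) ^+ 2 = (t * cabs (u n) - cabs (v n)) ^+ 2 / t.
    by field; rewrite gt_eqF.
  by rewrite divr_ge0 ?sqr_ge0// ltW.
have t1 : 0 <= 1 + t by rewrite addr_ge0 ?ltW.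
have t2 : 0 <= 1 + t^-1 by rewrite addr_ge0 ?invr_ge0 ?ltW.
have sq (z : R[i]) n : 0 <= cabs z ^+ 2 * w n ^+ 2 by rewrite mulr_ge0 ?sqr_ge0.
rewrite esumD; first last.
- by move=> n _; rewrite lee_fin mulr_ge0.
- by move=> n _; rewrite lee_fin mulr_ge0.
by apply: leeD; apply: esum_le_scale.
Qed.

Lemma ell2_normB u v : ell2_norm (u - v) <= ell2_norm u + ell2_norm v.
Proof. by rewrite -(ell2_normN v) ell2_normD. Qed.

Lemma ell2_norm_sum (I : Type) (r : seq I) (P : pred I) (F : I -> ell2 w) :
  ell2_norm (\sum_(i <- r | P i) F i) <= \sum_(i <- r | P i) ell2_norm (F i).
Proof.
elim/big_ind2 : _ => [|x1 x2 y1 y2 h1 h2|//]; first by rewrite ell2_norm0.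
by apply: (le_trans (ell2_normD _ _)); exact: lerD.
Qed.

Lemma ell2_val_sum (I : Type) (r : seq I) (P : pred I) (F : I -> ell2 w) n :
  (\sum_(i <- r | P i) F i) n = \sum_(i <- r | P i) F i n.
Proof. by elim/big_rec2 : _ => [//|i x y _ <-]. Qed.

(** Fatou's lemma for a sum: each finite partial sum is a limit of partial sums bounded by [B ^+ 2],
    and [sqsum] is the supremum of the finite ones. *)
Lemma sqsum_fatou (v : int -> R[i]) (vk : nat -> ell2 w) (B : R) :
  (forall k, ell2_norm (vk k) <= B) ->
  (forall n, ((fun k => vk k n) : nat -> R[i]^o) @ \oo --> (v n : R[i]^o)) ->
  (sqsum w v <= (B ^+ 2)%:E)%E.
Proof.
move=> hB hv; apply: ge_ereal_sup => _ [A [Afin _] <-].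
rewrite fsbig_finite// sumEFin lee_fin.
set s := finmap.enum_fset _.
have hn n : (fun k => cabs (vk k n)) @ \oo --> cabs (v n).
  apply/cvgrPdist_lt => e e0.
  have /complex_cvgP/(_ _ e0)[N hN] := hv n; exists N => // k /hN /=.
  apply: le_lt_trans; rewrite ler_norml cabs_dist andbT.
  by rewrite cabsB lerNl opprB cabs_dist.
have hs : (fun k => \sum_(n <- s) (cabs (vk k n) ^+ 2 * w n ^+ 2)) @ \oo -->
    \sum_(n <- s) (cabs (v n) ^+ 2 * w n ^+ 2).
  apply: cvg_big => [|n _]; first exact: add_continuous.
  apply: cvgMr_tmp.
  by rewrite expr2; under eq_fun do rewrite expr2; apply: cvgM; exact: hn.
apply: (cvgr_to_le hs); apply: nearW => k /=.
have B0 : 0 <= B by apply: le_trans (hB 0%N); exact: ell2_norm_ge0.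
apply: (@le_trans _ _ (ell2_norm (vk k) ^+ 2)); last first.
  by rewrite ler_sqr ?nnegrE ?ell2_norm_ge0.
rewrite -lee_fin ell2_norm_sqr -sumEFin /s -fsbig_finite//.
by apply: ereal_sup_ubound; exists A.
Qed.

Definition delta_seq (k : int) : int -> R[i] := fun n => (n == k)%:R.

Lemma esum_eq_point (x : \bar R) (k : int) : (0 <= x)%E ->
  (\esum_(n in [set: int]) (if n == k then x else 0) = x)%E.
Proof.
move=> x0; rewrite -[RHS](@esum_set1 _ _ k (fun=> x))// [RHS]esum_mkcond.
apply: eq_esum => n _; congr (if _ then _ else _).
by apply/eqP/idP => [->|/set_mem//]; apply/mem_set.
Qed.

Lemma delta_seq_ell2 k : delta_seq k \in ell2_pred w.
Proof.
rewrite ell2P; apply/asboolP.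
apply: (@le_lt_trans _ _ (w k ^+ 2)%:E); last exact: ltry.
rewrite -[leRHS](@esum_eq_point _ k) ?lee_fin ?sqr_ge0//.
apply: le_esum => n _; rewrite /delta_seq; case: eqP => [->|_].
  by rewrite Normc.normc1 expr1n mul1r.
by rewrite Normc.normc0 expr0n mul0r.
Qed.

Definition delta k : ell2 w := Ell2 (delta_seq_ell2 k).

Lemma scale_delta_coord (c : R[i]) k n : (c *: delta k) n = c * (n == k)%:R.
Proof. by []. Qed.

Lemma sum_delta_coord (p : nat -> int) (c : nat -> R[i]) n i :
  {in gtn n &, injective p} -> (i < n)%N ->
  (\sum_(j < n) c j *: delta (p j)) (p i) = c i.
Proof.
move=> pinj hi; rewrite ell2_val_sum (bigD1 (Ordinal hi))// big1.
  by rewrite scale_delta_coord eqxx mulr1; exact: addr0.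
move=> j; rewrite andTb => /eqP ji; rewrite scale_delta_coord.
case: eqP => [/pinj|_]; last by rewrite mulr0.
rewrite !inE => /(_ hi (ltn_ord j)) ij.
by exfalso; apply: ji; apply: val_inj.
Qed.

Lemma ell2_norm_sum_delta (p : nat -> int) (c : nat -> R[i]) n :
  {in gtn n &, injective p} ->
  ell2_norm (\sum_(i < n) c i *: delta (p i)) ^+ 2 =
  \sum_(i < n) cabs (c i) ^+ 2 * w (p i) ^+ 2.
Proof.
move=> pinj; apply: EFin_inj; rewrite ell2_norm_sqr -sumEFin /sqsum.
set u := (\sum_(i < n) _)%R.
transitivity (\esum_(m in [set: int]) \sum_(i < n)
    (if m == p i then (cabs (c i) ^+ 2 * w (p i) ^+ 2)%:E else 0))%E.
  apply: eq_esum => m _.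
  have [[i ->]|hm] := pselect (exists i : 'I_n, m = p i).
    rewrite (bigD1 i)// eqxx big1; last first.
      move=> j /andP[_ ji]; case: eqP => // /pinj.
      by rewrite !inE => /(_ (ltn_ord i) (ltn_ord j))/val_inj ij; rewrite ij eqxx in ji.
    by rewrite /u sum_delta_coord//; exact/esym/adde0.
  rewrite big1; last by move=> i _; case: eqP => // mi; exfalso; apply: hm; exists i.
  rewrite /u ell2_val_sum big1 ?Normc.normc0 ?expr0n ?mul0r// => i _.
  rewrite scale_delta_coord; case: eqP => [mi|_]; last by rewrite mulr0.
  by exfalso; apply: hm; exists i.
rewrite esum_sum; last by move=> m i _ _; case: ifP => // _; rewrite lee_fin mulr_ge0 ?sqr_ge0.
by apply: eq_bigr => i _; rewrite esum_eq_point// lee_fin mulr_ge0 ?sqr_ge0.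
Qed.

Lemma ell2_norm_delta k : ell2_norm (delta k) = w k.
Proof.
have := @ell2_norm_sum_delta (fun=> k) (fun=> 1) 1.
rewrite !big_ord1 scale1r Normc.normc1 expr1n mul1r => /(_ _)/eqP.
rewrite eqrXn2 ?ell2_norm_ge0 ?ltW ?wt_gt0// => /(_ _)/eqP; apply.
by move=> i j; rewrite !inE !ltnS !leqn0 => /eqP-> /eqP->.
Qed.

End Ell2Norm.

(** * Bounded operators and powers of the shift *)

Section BoundedOperators.
Variable R : realType.
Implicit Types w : weight R.

Lemma opnorm_le w1 w2 (A : ell2 w1 -> ell2 w2) (C : R) : 0 <= C ->
  (forall u, ell2_norm (A u) <= C * ell2_norm u) -> (opnorm A <= C%:E)%E.
Proof.
move=> C0 h; apply: ge_ereal_sup => _ [u /= u1 <-]; rewrite lee_fin.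
by rewrite (le_trans (h u))// ler_piMr.
Qed.

Lemma opnorm_leP w1 w2 (A : {linear ell2 w1 -> ell2 w2}) (C : R) :
  (opnorm A <= C%:E)%E -> forall u, ell2_norm (A u) <= C * ell2_norm u.
Proof.
move=> h u; have [/ell2_norm_eq0 ->|u0] := eqVneq (ell2_norm u) 0.
  by rewrite linear0 !ell2_norm0 mulr0.
have up : 0 < ell2_norm u by rewrite lt0r u0 ell2_norm_ge0.
pose t : R[i] := (ell2_norm u)%:C%C; pose v := t^-1 *: u.
have tE : cabs t = ell2_norm u by rewrite cabs_real gtr0_norm.
have t0 : t != 0 by rewrite -cabs_eq0 tE.
have v1 : ell2_norm v <= 1.
  by rewrite (le_trans (ell2_normZ_le _ _))// Normc.normcV tE mulVf.
have Av : ell2_norm (A v) <= C.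
  by rewrite -lee_fin (le_trans _ h)//; apply: ereal_sup_ubound; exists v.
have uE : u = t *: v by rewrite scalerA mulfV// scale1r.
rewrite {1}uE linearZ (le_trans (ell2_normZ_le _ _))// tE mulrC.
by apply: ler_wpM2r; first exact: ltW.
Qed.

Lemma bop_bound w1 w2 (A : bop w1 w2) :
  exists2 C : R, 0 < C & forall u, ell2_norm (A u) <= C * ell2_norm u.
Proof.
suff [C C0 hC] : exists2 C : R, 0 < C & (opnorm A <= C%:E)%E.
  by exists C => //; exact: opnorm_leP.
have := bop_bounded A; case: opnorm => [r _|//|_]; last first.
  by exists 1; rewrite ?ltr01 ?leNye.
exists (Num.max 1 r); first by rewrite lt_max ltr01.
by rewrite lee_fin le_max lexx orbT.
Qed.

Lemma bop_exists w1 w2 (f : ell2 w1 -> ell2 w2) (C : R) : 0 <= C ->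
  linear f -> (forall u, ell2_norm (f u) <= C * ell2_norm u) ->
  exists A : bop w1 w2, forall u, A u = f u.
Proof.
move=> C0 lf hf.
pose g : {linear ell2 w1 -> ell2 w2} :=
  HB.pack f (GRing.isLinear.Build R[i] (ell2 w1) (ell2 w2) *:%R f lf).
have hg : (opnorm g < +oo)%E.
  by apply: (@le_lt_trans _ _ C%:E); [exact: opnorm_le|exact: ltry].
by exists (Bop hg).
Qed.

Lemma bop_comp_exists w1 w2 w3 (A : bop w2 w3) (B : bop w1 w2) :
  exists X : bop w1 w3, forall u, X u = A (B u).
Proof.
have [a a0 hA] := bop_bound A; have [b b0 hB] := bop_bound B.
apply: (@bop_exists _ _ _ (a * b)); first by rewrite mulr_ge0// ltW.
  by move=> c u v; rewrite !linearP.
by move=> u; rewrite (le_trans (hA _))// -mulrA ler_wpM2l// ltW.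
Qed.

(** The lower bound makes [A] injective, which makes a pointwise chosen right inverse linear and
    two-sided; the same lower bound is the boundedness of that inverse. *)
Lemma op_invertible_of_bijective w1 w2 (A : ell2 w1 -> ell2 w2) (C : R) :
  0 <= C -> linear A -> (forall u, ell2_norm u <= C * ell2_norm (A u)) ->
  (forall v, exists u, A u = v) -> op_invertible A.
Proof.
move=> C0 lA hC /choice[B AB].
have Ainj u v : A u = A v -> u = v.
  move=> uv; apply/eqP; rewrite -subr_eq0; apply/eqP/ell2_norm_eq0.
  apply/eqP; rewrite eq_le ell2_norm_ge0 andbT (le_trans (hC _))//.
  have -> : A (u - v) = 0.
    by rewrite addrC -[- v]scaleN1r lA uv scaleN1r addNr.
  by rewrite ell2_norm0 mulr0.
have [|v|X hX] := @bop_exists _ _ B C C0.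
- by move=> c u v; apply: Ainj; rewrite lA !AB.
- by rewrite -{2}[v]AB.
by exists X; split=> u; rewrite hX ?AB//; apply: Ainj; rewrite AB.
Qed.

Lemma op_similar_trans w1 w2 w3 (A : bop w1 w1) (B : bop w2 w2) (C : bop w3 w3) :
  op_similar A B -> op_similar B C -> op_similar A C.
Proof.
move=> [Y [Z [YZ ZY hB]]] [Y' [Z' [YZ' ZY' hC]]].
have [X hX] := bop_comp_exists Y' Y; have [X' hX'] := bop_comp_exists Z Z'.
exists X, X'; split => u.
- by rewrite hX hX' YZ' YZ.
- by rewrite hX hX' ZY ZY'.
by rewrite hX hX' hC hB.
Qed.

Lemma op_similar_sym w1 w2 (A : bop w1 w1) (B : bop w2 w2) :
  op_similar A B -> op_similar B A.
Proof.
move=> [Y [Z [YZ ZY hB]]]; exists Z, Y; split=> // u.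
by rewrite hB !YZ.
Qed.

Lemma op_invertible_similar w1 w2 (Y : bop w1 w2) (Z : bop w2 w1)
    (A : ell2 w1 -> ell2 w1) (B : ell2 w2 -> ell2 w2) :
  cancel Y Z -> cancel Z Y -> (forall v, B v = Y (A (Z v))) ->
  op_invertible A -> op_invertible B.
Proof.
move=> YZ ZY hB [X [AX XA]].
have [X1 hX1] := bop_comp_exists X Z; have [X2 hX2] := bop_comp_exists Y X1.
exists X2; split => u; rewrite hX2 hX1 hB.
- by rewrite YZ AX ZY.
- by rewrite YZ XA ZY.
Qed.

End BoundedOperators.

(** * Powers of the shift, and invertibility of [S - 1] when the weight decays geometrically *)

Section ShiftPowers.
Variables (R : realType) (w : weight R).
Implicit Types (u v : ell2 w).

Lemma iter_shift_coord k u n : iter k (wshift w) u n = u (n - k%:Z).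
Proof.
elim: k n => [|k ih] n; first by rewrite subr0.
by rewrite iterS /= /shift_seq ih -addn1 PoszD opprD addrAC addrA.
Qed.

Lemma shift_delta k : wshift w (delta w k) = delta w (k + 1).
Proof.
apply/val_inj/funext => n; rewrite /= /shift_seq /delta_seq.
by rewrite subr_eq.
Qed.

Lemma iter_shift_norm_le k (c : R) : 0 <= c ->
  (forall n, w (n + k%:Z) <= c * w n) ->
  forall u, ell2_norm (iter k (wshift w) u) <= c * ell2_norm u.
Proof.
move=> c0 hc u; apply: ell2_norm_le; first by rewrite mulr_ge0 ?ell2_norm_ge0.
rewrite exprMn EFinM ell2_norm_sqr /sqsum.
rewrite (@reindex_esum _ _ _ setT setT (fun n : int => n + k%:Z)); last first.
  split=> [//|n m _ _ /addIr//|n _].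
  by exists (n - k%:Z) => //; rewrite subrK.
apply: esum_le_scale => [|n|n]; first exact: sqr_ge0.
  by rewrite mulr_ge0 ?sqr_ge0.
rewrite iter_shift_coord addrK [leRHS]mulrCA; apply: ler_wpM2l; rewrite ?sqr_ge0//.
by rewrite -exprMn ler_sqr ?nnegrE ?mulr_ge0// ltW// wt_gt0.
Qed.

Hypothesis contr : (opnorm (wshift w) <= 1)%E.

Lemma contractive_weight_succ n : w (n + 1) <= w n.
Proof.
have := opnorm_leP contr (delta w n).
by rewrite shift_delta !ell2_norm_delta mul1r.
Qed.

Lemma contractive_weight n k : w (n + k%:Z) <= w n.
Proof.
elim: k => [|k ih]; first by rewrite addr0.
by rewrite -addn1 PoszD addrA (le_trans (contractive_weight_succ _)).
Qed.

Lemma iter_shift_contractive k u : ell2_norm (iter k (wshift w) u) <= ell2_norm u.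
Proof.
rewrite -[leRHS]mul1r; apply: iter_shift_norm_le => // n.
by rewrite mul1r contractive_weight.
Qed.

Section Neumann.
Variable L : nat.
Hypothesis half : forall n, w (n + L%:Z) <= w n / 2.

Let T := iter L (wshift w).

Let T_half u : ell2_norm (T u) <= 2^-1 * ell2_norm u.
Proof. by apply: iter_shift_norm_le => // n; rewrite mulrC. Qed.

Let T_iter_half k u : ell2_norm (iter (k * L) (wshift w) u) <= 2^-1 ^+ k * ell2_norm u.
Proof.
elim: k => [|k ih]; first by rewrite mul0n expr0 mul1r.
rewrite mulSn iterD (le_trans (T_half _))// exprS -mulrA.
by apply: ler_wpM2l; rewrite ?invr_ge0.
Qed.

(* The solution is the coordinatewise sum of the Neumann series of [T]. *)
Let neumann u : exists v, v - T v = u.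
Proof.
have half01 : 0 <= (2^-1 : R) < 1 by apply/andP; split; lra.
pose c n k := u (n - (k * L)%:Z).
have c_le n k : cabs (c n k) <= ell2_norm u / w n * 2^-1 ^+ k.
  rewrite mulrAC ler_pdivlMr ?wt_gt0// mulrC [X in _ <= X]mulrC mulrC.
  by apply: le_trans (T_iter_half k u); rewrite /c -iter_shift_coord ell2_coord_le.
have c_cvg n : exists l : R[i], (series (c n) : nat -> R[i]^o) @ \oo --> (l : R[i]^o).
  apply: (@series_geometric_cvg _ _ (ell2_norm u / w n) 2^-1) => //.
  by rewrite divr_ge0 ?ell2_norm_ge0// ltW// wt_gt0.
have [v hv] := choice c_cvg.
pose vk m := \sum_(k < m) iter (k * L) (wshift w) u.
have vkE m n : vk m n = series (c n) m.
  rewrite seriesEnat /= big_mkord /vk ell2_val_sum.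
  by apply: eq_bigr => k _; rewrite iter_shift_coord.
have vk_le m : ell2_norm (vk m) <= 2 * ell2_norm u.
  apply: le_trans (ell2_norm_sum _ _ _) _.
  apply: (@le_trans _ _ (\sum_(k < m) 2^-1 ^+ k * ell2_norm u)).
    by apply: ler_sum => k _; exact: T_iter_half.
  rewrite -mulr_suml; apply: ler_wpM2r; first exact: ell2_norm_ge0.
  have := @geometric_sum_le _ (2^-1 : R) 0 m half01; rewrite big_mkord expr0.
  have -> : 1 / (1 - 2^-1) = 2 :> R by field.
  exact.
have v2 : v \in ell2_pred w.
  rewrite ell2P; apply/asboolP.
  apply: (@le_lt_trans _ _ ((2 * ell2_norm u) ^+ 2)%:E); last exact: ltry.
  apply: (sqsum_fatou vk_le) => n.
  by rewrite (_ : (fun k => vk k n) = series (c n))//; apply/funext => m.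
exists (Ell2 v2); apply/val_inj/funext => n.
change (v n - T (Ell2 v2) n = u n); rewrite /T iter_shift_coord /=.
apply/eqP; rewrite subr_eq; apply/eqP.
(* Splitting off the term of index 0 from the series at [n] leaves the series at [n - L]. *)
apply: (@complex_cvg_unique _ (fun k => series (c n) k.+1)).
  by rewrite cvg_shiftS; exact: hv.
rewrite (_ : (fun k => _) = (fun k => u n + series (c (n - L%:Z)) k)).
  by apply: (@cvgD _ R[i]^o); [exact: cvg_cst|exact: hv].
apply/funext => m; rewrite !seriesEnat /= big_nat_recl//= /c mul0n subr0.
congr (_ + _); apply: eq_bigr => k _; congr (u _).
by rewrite mulSn PoszD opprD addrA.
Qed.

(** [T = S^L] has norm at most 1/2, and [1 - T] is [1 - S] times [1 + S + ... + S^(L-1)].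
    Telescoping with the contraction [S] gives [||u - T u|| <= L ||S u - u||], while
    [||u - T u|| >= ||u|| / 2]; this is the lower bound with constant [2 L]. Surjectivity comes from
    applying the geometric sum to a solution of [v - T v = - y]. *)
Lemma shift_sub1_invertible : op_invertible (fun u => wshift w u - 1 *: u).
Proof.
pose D u := wshift w u - 1 *: u.
have DE u : D u = wshift w u - u by rewrite /D scale1r.
have linD : linear D by move=> a u v; rewrite !DE linearP scalerBr opprD addrACA.
have iter_le k u : ell2_norm (u - iter k (wshift w) u) <= k%:R * ell2_norm (D u).
  elim: k => [|k ih]; first by rewrite subrr ell2_norm0 mul0r.
  have -> : u - iter k.+1 (wshift w) u =
      (u - iter k (wshift w) u) - iter k (wshift w) (D u).
    have -> : iter k (wshift w) (D u) =
        iter k.+1 (wshift w) u - iter k (wshift w) u.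
      rewrite DE iterSr; apply/val_inj/funext => n.
      change (iter k (wshift w) (wshift w u - u) n =
        iter k (wshift w) (wshift w u) n - iter k (wshift w) u n).
      by rewrite !iter_shift_coord.
    by rewrite opprB addrA subrK.
  rewrite (le_trans (ell2_normB _ _))// -addn1 natrD mulrDl mul1r lerD//.
  exact: iter_shift_contractive.
apply: (@op_invertible_of_bijective _ _ _ _ (2 * L%:R)).
- by rewrite mulr_ge0.
- exact: linD.
- move=> u; rewrite -mulrA.
  have h1 := iter_le L u; have h2 := T_half u.
  have := ell2_normD (u - T u) (T u); rewrite subrK -/(D u).
  rewrite -/T in h1; lra.
move=> y; have [v hv] := neumann (- y).
exists (\sum_(i < L) iter i (wshift w) v).
rewrite -/(D _) DE linear_sum -sumrB.
rewrite (eq_bigr (fun i : 'I_L => iter i.+1 (wshift w) v - iter i (wshift w) v))//.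
rewrite -(big_mkord xpredT (fun i => iter i.+1 (wshift w) v - iter i (wshift w) v)).
by rewrite telescope_sumr// -[y]opprK -hv opprB.
Qed.

End Neumann.

End ShiftPowers.

(** * Trapezoids around a peak *)

Section Trapezoid.
Variables (R : realType) (G : nat -> R) (s k : R) (W p r : nat).
Hypotheses (G_gt0 : forall i, 0 < G i) (G_succ : forall i, G i.+1 <= s * G i).
Hypotheses (s1 : 1 <= s) (W0 : (0 < W)%N) (k0 : 0 <= k).
(* [G] grows by at most [s ^+ W] along a ramp of width [W], hence stays small there
   compared with its values on the [W] points up to [p]. *)
Hypothesis k_small : 2 * k * s ^+ W ^+ 2 <= 1.
Hypotheses (G0p : G 0 <= k * G p) (Grp : G r <= k * G p) (pr : (p <= r)%N).

Let G_growth i j : G (i + j) <= s ^+ j * G i.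
Proof.
elim: j => [|j ih]; first by rewrite addn0 expr0 mul1r.
rewrite addnS (le_trans (G_succ _))// exprS -mulrA ler_wpM2l//.
exact: le_trans s1.
Qed.

Let G_growth_W i j : (j <= W)%N -> G (i + j) <= s ^+ W * G i.
Proof.
move=> jW; rewrite (le_trans (G_growth _ _))//.
by rewrite ler_wpM2r ?ler_weXn2l// ltW.
Qed.

(** Otherwise [G] would climb from [G 0] to [G p] in fewer than [2 W] steps, gaining at most
    [s ^+ W ^+ 2], although [G 0 <= k * G p] requires twice that. *)
Let p_far : (2 * W <= p)%N.
Proof.
rewrite leqNgt; apply/negP => pW.
have h1 : G p <= s ^+ W ^+ 2 * G 0.
  rewrite -exprM mulnC -{1}[p]add0n (le_trans (G_growth _ _))//.
  by rewrite ler_wpM2r ?(ltW (G_gt0 _))// ler_weXn2l//; lia.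
have h2 : s ^+ W ^+ 2 * G 0 <= s ^+ W ^+ 2 * (k * G p).
  by rewrite ler_wpM2l// sqr_ge0.
have h3 : 2 * k * s ^+ W ^+ 2 * G p <= 1 * G p by rewrite ler_wpM2r// ltW.
have := G_gt0 p; lra.
Qed.

Let n := (r + W)%N.
(** The trapezoid: up with slope 1 on [[0, W]], constant on [[W, r]], down to zero on [[r, n]]. *)
Let v i : R := (minn W (minn i (n - i)))%:R.

(** Increments of [v] vanish on the plateau and are at most 1 on the two ramps. The ramps have [W]
    indices each and start at 0 and at [r], where [G] is at most [k * G p]. *)
Let error_le : \sum_(i < n) (v i.+1 - v i) ^+ 2 * G i.+1 ^+ 2 <=
  2 * W%:R * (s ^+ W * k * G p) ^+ 2.
Proof.
have s0 : 0 <= s by exact: le_trans s1.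
have small i : G i.+1 <= s ^+ W * k * G p ->
    (v i.+1 - v i) ^+ 2 * G i.+1 ^+ 2 <= (s ^+ W * k * G p) ^+ 2.
  move=> h; rewrite -[leRHS]mul1r; apply: ler_pM; rewrite ?sqr_ge0//; last first.
    by rewrite lerXn2r// nnegrE ?mulr_ge0 ?exprn_ge0// ltW.
  have : `|v i.+1 - v i| <= 1.
    have [] : (minn W (minn i.+1 (n - i.+1)) <= (minn W (minn i (n - i))).+1)%N /\
        (minn W (minn i (n - i)) <= (minn W (minn i.+1 (n - i.+1))).+1)%N by lia.
    by rewrite -!(ler_nat R) -!natr1 /v ler_norml => h1 h2; apply/andP; split; lra.
  by rewrite -real_normK ?num_real// => h1; rewrite exprn_ile1.
have Wr : (W <= r)%N by move: p_far pr; lia.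
rewrite -(big_mkord xpredT (fun i => (v i.+1 - v i) ^+ 2 * G i.+1 ^+ 2)).
rewrite (big_cat_nat (leq0n W) (leq_trans Wr (leq_addr W r)))//=.
rewrite (big_cat_nat Wr (leq_addr W r))//=.
rewrite [X in _ + (X + _)]big_nat_cond [X in _ + (X + _)]big1 ?add0r; last first.
  move=> i /andP[/andP[Wi ir] _].
  have -> : v i.+1 = v i by congr (_%:R); rewrite /n; lia.
  by rewrite subrr expr0n mul0r.
have -> : 2 * W%:R * (s ^+ W * k * G p) ^+ 2 =
    (s ^+ W * k * G p) ^+ 2 *+ (W - 0) + (s ^+ W * k * G p) ^+ 2 *+ (r + W - r).
  by rewrite subn0 addKn -mulr_natl; ring.
rewrite -!sumr_const_nat; apply: lerD; apply: ler_sum_nat => i /andP[hi1 hi2]; apply: small.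
  rewrite -[i.+1]add0n (le_trans (G_growth_W _ _))//.
  by rewrite -mulrA ler_wpM2l// exprn_ge0.
have -> : i.+1 = (r + (i.+1 - r))%N by lia.
rewrite (le_trans (G_growth_W _ _))//; first by lia.
by rewrite -mulrA ler_wpM2l// exprn_ge0.
Qed.

(** Only the [W] indices ending at [p] are kept: they lie on the plateau, and [G] there is at least
    [G p] divided by [s ^+ W]. *)
Let plateau_ge : W%:R ^+ 3 * G p ^+ 2 <=
  s ^+ W ^+ 2 * \sum_(i < n) v i ^+ 2 * G i ^+ 2.
Proof.
have s0 : 0 <= s by exact: le_trans s1.
rewrite -(big_mkord xpredT (fun i => v i ^+ 2 * G i ^+ 2)).
have h1 : (p.+1 - W <= p.+1)%N by lia.
have h2 : (p.+1 <= n)%N by rewrite /n; lia.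
rewrite (big_cat_nat (leq0n _) (leq_trans h1 h2))//= (big_cat_nat h1 h2)//=.
have pos m1 m2 : 0 <= \sum_(m1 <= i < m2) v i ^+ 2 * G i ^+ 2.
  by apply: sumr_ge0 => i _; rewrite mulr_ge0 ?sqr_ge0.
apply: (@le_trans _ _ (s ^+ W ^+ 2 *
    \sum_(p.+1 - W <= i < p.+1) v i ^+ 2 * G i ^+ 2)); last first.
  rewrite ler_wpM2l ?sqr_ge0//.
  by have := pos 0%N (p.+1 - W)%N; have := pos p.+1 n; lra.
have -> : W%:R ^+ 3 * G p ^+ 2 = \sum_(p.+1 - W <= i < p.+1) (W%:R * G p) ^+ 2.
  rewrite sumr_const_nat subKn; last by move: p_far; lia.
  by rewrite -mulr_natl; ring.
rewrite mulr_sumr; apply: ler_sum_nat => i /andP[hi1 hi2].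
have -> : v i = W%:R.
  by rewrite /v; congr (_%:R); rewrite /n; move: p_far pr hi1 hi2; lia.
rewrite mulrCA -!exprMn lerXn2r ?nnegrE ?mulr_ge0 ?exprn_ge0 ?(ltW (G_gt0 _))//.
rewrite ler_wpM2l//.
have -> : p = (i + (p - i))%N by lia.
by apply: G_growth_W; lia.
Qed.

(** The two estimates bound the quotient of error and mass by [2 x^2 / W^2] with
    [x = k * s ^+ W ^+ 2], and [x <= 1/2]. *)
Lemma trapezoid_of_peak : exists n (v : nat -> R),
  [/\ v 0%N = 0, v n = 0, 0 < \sum_(i < n) v i ^+ 2 * G i ^+ 2 &
    \sum_(i < n) (v i - v i.+1) ^+ 2 * G i.+1 ^+ 2 <=
    W%:R^-1 ^+ 2 * \sum_(i < n) v i ^+ 2 * G i ^+ 2].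
Proof.
have s0 : 0 < s by exact: lt_le_trans s1.
have Wp : 0 < W%:R :> R by rewrite ltr0n.
have Bp : 0 < s ^+ W ^+ 2 by rewrite !exprn_gt0.
exists n, v; split.
- by rewrite /v min0n minn0.
- by rewrite /v subnn !minn0.
- rewrite -(pmulr_rgt0 _ Bp); apply: lt_le_trans plateau_ge.
  by rewrite mulr_gt0 ?exprn_gt0.
under eq_bigr do rewrite -sqrrN opprB.
rewrite (le_trans error_le)// exprVn ler_pdivlMl ?exprn_gt0//.
rewrite -(ler_pM2l Bp) (le_trans _ plateau_ge)//.
have -> : s ^+ W ^+ 2 * (W%:R ^+ 2 * (2 * W%:R * (s ^+ W * k * G p) ^+ 2)) =
    (2 * (k * s ^+ W ^+ 2) ^+ 2) * (W%:R ^+ 3 * G p ^+ 2) by ring.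
apply: ler_piMl; first by rewrite mulr_ge0 ?sqr_ge0 ?exprn_ge0.
have kB0 : 0 <= k * s ^+ W ^+ 2 by rewrite mulr_ge0 ?sqr_ge0.
have kB1 : 2 * (k * s ^+ W ^+ 2) <= 1 by rewrite mulrA.
move: kB0 kB1; move: (k * s ^+ W ^+ 2) => x x0 x1.
have : 0 <= x * (1 - 2 * x) by rewrite mulr_ge0// subr_ge0.
by rewrite expr2; lra.
Qed.

End Trapezoid.

(** The higher of the two humps serves as the peak for both ends. *)
Lemma trapezoid_of_two_humps (R : realType) (G : nat -> R) (s k : R) (W p1 p2 r : nat) :
  (forall i, 0 < G i) -> (forall i, G i.+1 <= s * G i) -> 1 <= s ->
  (0 < W)%N -> 0 <= k -> 2 * k * s ^+ W ^+ 2 <= 1 ->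
  G 0%N <= k * G p1 -> G r <= k * G p2 -> (p1 <= r)%N -> (p2 <= r)%N ->
  exists n (v : nat -> R),
  [/\ v 0%N = 0, v n = 0, 0 < \sum_(i < n) v i ^+ 2 * G i ^+ 2 &
    \sum_(i < n) (v i - v i.+1) ^+ 2 * G i.+1 ^+ 2 <=
    W%:R^-1 ^+ 2 * \sum_(i < n) v i ^+ 2 * G i ^+ 2].
Proof.
move=> Gp Gs s1 W0 k0 ks G1 G2 p1r p2r; have [h|h] := leP (G p1) (G p2).
  apply: (trapezoid_of_peak Gp Gs s1 W0 k0 ks _ G2 p2r).
  by rewrite (le_trans G1)// ler_wpM2l.
apply: (trapezoid_of_peak Gp Gs s1 W0 k0 ks G1 _ p1r).
by rewrite (le_trans G2)// ler_wpM2l// ltW.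
Qed.

(** * Approximate eigenvectors and eigenfunctionals *)

Section NearEigen.
Variables (R : realType) (w : weight R) (l : R[i]) (n : nat) (v : nat -> R) (e : R).
Hypotheses (l0 : l != 0) (l1 : cabs l <= 1) (e0 : 0 <= e).
Hypotheses (v0 : v 0%N = 0) (vn : v n = 0).

(** The Cauchy-Schwarz inequality for a finitely supported functional, whose norm is taken with the
    dual weight [1 / w]. *)
Lemma ell2_pairing_le (d : nat -> R[i]) (p : nat -> int) (m : nat) (M : R) (y : ell2 w) :
  {in gtn m &, injective p} -> 0 <= M ->
  \sum_(i < m) (cabs (d i) / w (p i)) ^+ 2 <= M ^+ 2 ->
  cabs (\sum_(i < m) d i * y (p i)) <= M * ell2_norm y.
Proof.
move=> pinj M0 hM.
have hy : \sum_(i < m) (cabs (y (p i)) * w (p i)) ^+ 2 <= ell2_norm y ^+ 2.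
  under eq_bigr do rewrite exprMn.
  rewrite -(ell2_norm_sum_delta w (fun i => y (p i)) pinj) -lee_fin !ell2_norm_sqr.
  apply: le_esum => k _; rewrite lee_fin ler_wpM2r ?sqr_ge0//.
  rewrite lerXn2r ?nnegrE ?cabs_ge0//.
  have [[i ->]|hk] := pselect (exists i : 'I_m, k = p i).
    by rewrite (sum_delta_coord w (fun i => y (p i)) pinj).
  rewrite ell2_val_sum big1 ?Normc.normc0 ?cabs_ge0// => i _.
  rewrite scale_delta_coord; case: eqP => [ki|_]; last by rewrite mulr0.
  by exfalso; apply: hk; exists i.
(* [a b <= t a^2 / 2 + b^2 / (2 t)] with [t = N' / M'], for [M' > M] and [N' > ||y||]. *)
have key (M' N' : R) : M < M' -> ell2_norm y < N' ->
    cabs (\sum_(i < m) d i * y (p i)) <= M' * N'.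
  move=> MM' yN'.
  have M'0 : 0 < M' by exact: le_lt_trans MM'.
  have N'0 : 0 < N' by apply: le_lt_trans yN'; exact: ell2_norm_ge0.
  rewrite (le_trans (cabs_sum _ _ _))//.
  apply: (@le_trans _ _ (\sum_(i < m) (N' / M' / 2 * (cabs (d i) / w (p i)) ^+ 2 +
      M' / N' / 2 * (cabs (y (p i)) * w (p i)) ^+ 2))).
    apply: ler_sum => i _; have wp := wt_gt0 w (p i).
    rewrite cabsM -subr_ge0.
    set a := cabs (d i); set b := cabs (y (p i)).
    have -> : N' / M' / 2 * (a / w (p i)) ^+ 2 + M' / N' / 2 * (b * w (p i)) ^+ 2 - a * b =
        (N' * (a / w (p i)) - M' * (b * w (p i))) ^+ 2 / (2 * M' * N').
      by field; rewrite !gt_eqF.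
    by rewrite divr_ge0 ?sqr_ge0// !mulr_ge0// ltW.
  rewrite big_split /= -!mulr_sumr.
  have h1 : N' / M' / 2 * (\sum_(i < m) (cabs (d i) / w (p i)) ^+ 2) <=
      N' / M' / 2 * M' ^+ 2.
    rewrite ler_wpM2l ?divr_ge0 ?(ltW M'0) ?(ltW N'0)// (le_trans hM)//.
    by rewrite lerXn2r ?nnegrE ?(ltW M'0)// ltW.
  have h2 : M' / N' / 2 * (\sum_(i < m) (cabs (y (p i)) * w (p i)) ^+ 2) <=
      M' / N' / 2 * N' ^+ 2.
    rewrite ler_wpM2l ?divr_ge0 ?(ltW M'0) ?(ltW N'0)// (le_trans hy)//.
    by rewrite lerXn2r ?nnegrE ?ell2_norm_ge0 ?(ltW N'0)// ltW.
  have -> : M' * N' = N' / M' / 2 * M' ^+ 2 + M' / N' / 2 * N' ^+ 2.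
    by field; rewrite !gt_eqF.
  exact: lerD.
(* Strict majorants kept the divisors nonzero; now [M'] decreases to [M], and afterwards [N'] to the
   norm of [y]. *)
have h1 (N' : R) : ell2_norm y < N' -> cabs (\sum_(i < m) d i * y (p i)) <= M * N'.
  move=> yN'; have N'0 : 0 < N' by apply: le_lt_trans yN'; exact: ell2_norm_ge0.
  rewrite -ler_pdivrMr//; apply/ler_addgt0Pr => t t0.
  by rewrite ler_pdivrMr// key// ltrDl.
have [M00|M1] := eqVneq M 0.
  by have := h1 _ (ltr_pwDr ltr01 (lexx (ell2_norm y))); rewrite M00 !mul0r.
have Mp : 0 < M by rewrite lt0r M1.
rewrite mulrC -ler_pdivrMr//; apply/ler_addgt0Pr => t t0.
by rewrite ler_pdivrMr// mulrC h1// ltrDl.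
Qed.

Let s := (cabs l)^-1.
(** For constant [v] this solves [c i = l * c i.+1], the recurrence both of an eigenvector and, read
    leftwards, of an eigenfunctional. The defect therefore comes from the increments of [v]
    alone. *)
Let c i : R[i] := l^-1 ^+ i * (v i)%:C%C.

Let s0 : 0 < s. Proof. by rewrite invr_gt0 cabs_gt0. Qed.

Let c_cabs i : cabs (c i) = s ^+ i * `|v i|.
Proof. by rewrite /c cabsM cabsX Normc.normcV cabs_real. Qed.

Let c_diff i : c i - l * c i.+1 = l^-1 ^+ i * (v i - v i.+1)%:C%C.
Proof. by rewrite /c exprS mulrA mulrA mulfV// mul1r -mulrBr -rmorphB. Qed.

(** One factor [s >= 1] is given away so that the index agrees with [G i.+1] in the trapezoid
    estimate. *)
Let c_diff_cabs i : cabs (c i - l * c i.+1) <= s ^+ i.+1 * `|v i - v i.+1|.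
Proof.
rewrite c_diff cabsM cabsX Normc.normcV cabs_real -/s.
rewrite ler_wpM2r// exprS ler_peMl ?exprn_ge0 ?(ltW s0)//.
by rewrite /s invf_ge1 ?cabs_gt0.
Qed.

Let c_diff_sqr_le i (x : R) : cabs (c i - l * c i.+1) ^+ 2 * x ^+ 2 <=
  (v i - v i.+1) ^+ 2 * (s ^+ i.+1 * x) ^+ 2.
Proof.
have -> : (v i - v i.+1) ^+ 2 * (s ^+ i.+1 * x) ^+ 2 =
    (s ^+ i.+1 * `|v i - v i.+1|) ^+ 2 * x ^+ 2.
  by rewrite [in RHS]exprMn real_normK ?num_real//; ring.
rewrite ler_wpM2r ?sqr_ge0// lerXn2r ?nnegrE ?cabs_ge0//.
by rewrite mulr_ge0 ?exprn_ge0// ltW.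
Qed.

(** Summation by parts; the boundary terms vanish with [v] at 0 and [n]. A general module covers
    both the vectors [delta] and the scalar coordinates of [y]. *)
Let sum_diff (V : lmodType R[i]) (F : nat -> V) :
  \sum_(i < n) c i *: (F i.+1 - l *: F i) =
  \sum_(i < n) (c i - l * c i.+1) *: F i.+1.
Proof.
under eq_bigr do rewrite scalerBr scalerA.
under [RHS]eq_bigr do rewrite scalerBl.
rewrite !sumrB; congr (_ - _).
have c0 : c 0%N = 0 by rewrite /c v0 mulr0.
have cn : c n = 0 by rewrite /c vn mulr0.
transitivity (\sum_(0 <= i < n.+1) (c i * l) *: F i).
  by rewrite big_nat_recr//= cn mul0r scale0r addr0 big_mkord.
rewrite big_nat_recl//= c0 mul0r scale0r add0r big_mkord.
by apply: eq_bigr => i _; rewrite mulrC.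
Qed.

Lemma near_eigenvector_exists (j : int) :
  \sum_(i < n) (v i - v i.+1) ^+ 2 * (s ^+ i.+1 * w (j + i.+1%:Z)) ^+ 2 <=
  e ^+ 2 * \sum_(i < n) v i ^+ 2 * (s ^+ i * w (j + i%:Z)) ^+ 2 ->
  exists u : ell2 w,
    ell2_norm u ^+ 2 = \sum_(i < n) v i ^+ 2 * (s ^+ i * w (j + i%:Z)) ^+ 2 /\
    ell2_norm (wshift w u - l *: u) <= e * ell2_norm u.
Proof.
move=> h.
have pinj (k : nat) m : {in gtn m &, injective (fun i : nat => j + (i + k)%N%:Z)}.
  by move=> a b _ _ /addrI[]/addIn.
pose u : ell2 w := \sum_(i < n) c i *: delta w (j + i%:Z).
have uE : ell2_norm u ^+ 2 = \sum_(i < n) v i ^+ 2 * (s ^+ i * w (j + i%:Z)) ^+ 2.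
  rewrite /u (@ell2_norm_sum_delta _ _ (fun i : nat => j + i%:Z) c); last first.
    by move=> a b _ _ /addrI[].
  apply: eq_bigr => i _.
  by rewrite c_cabs [in LHS]exprMn real_normK ?num_real//; ring.
exists u; split=> //.
have -> : wshift w u - l *: u =
    \sum_(i < n) (c i - l * c i.+1) *: delta w (j + (i + 1)%N%:Z).
  rewrite /u linear_sum /= scaler_sumr -sumrB.
  under [RHS]eq_bigr do rewrite addn1.
  rewrite -(sum_diff (fun i => delta w (j + i%:Z))); apply: eq_bigr => i _.
  rewrite linearZ /= -/(wshift w _) shift_delta scalerBr !scalerA mulrC.
  by rewrite -addrA -PoszD addn1.
rewrite -(@ler_pXn2r _ 2) ?nnegrE ?mulr_ge0 ?ell2_norm_ge0//.
rewrite (@ell2_norm_sum_delta _ _ (fun i : nat => j + (i + 1)%N%:Z) (fun i => c i - l * c i.+1));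
  last exact: pinj.
rewrite exprMn uE (le_trans _ h)//; apply: ler_sum => i _; rewrite addn1.
exact: c_diff_sqr_le.
Qed.

(** An approximate eigenvector of the adjoint, expressed as a functional [f] of norm [M] together
    with the vector [x] representing it. Its coordinates run leftwards from [j] because the adjoint
    shifts backwards. *)
Lemma near_eigenfunctional_exists (j : int) :
  0 < \sum_(i < n) v i ^+ 2 * (s ^+ i / w (j - i%:Z)) ^+ 2 ->
  \sum_(i < n) (v i - v i.+1) ^+ 2 * (s ^+ i.+1 / w (j - i.+1%:Z)) ^+ 2 <=
  e ^+ 2 * \sum_(i < n) v i ^+ 2 * (s ^+ i / w (j - i%:Z)) ^+ 2 ->
  exists (f : ell2 w -> R[i]) (x : ell2 w) (M : R),
    [/\ 0 < M, f x = (M ^+ 2)%:C%C, ell2_norm x = M,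
      (forall a y z, f (a *: y + z) = a * f y + f z) &
      (forall y, cabs (f y) <= M * ell2_norm y) /\
      (forall y, cabs (f (wshift w y - l *: y)) <= e * M * ell2_norm y)].
Proof.
set M2 := \sum_(i < n) _ => M20 h.
have pinj (k : nat) m : {in gtn m &, injective (fun i : nat => j - (i + k)%N%:Z)}.
  by move=> a b _ _ /addrI/oppr_inj[]/addIn.
have pinj0 m : {in gtn m &, injective (fun i : nat => j - i%:Z)}.
  by move=> a b _ _ /addrI/oppr_inj[].
pose M := Num.sqrt M2.
have M2E : M ^+ 2 = M2 by rewrite sqr_sqrtr// ltW.
have M0 : 0 < M by rewrite sqrtr_gt0.
pose f (y : ell2 w) : R[i] := \sum_(i < n) c i * y (j - i%:Z).
(* Coefficients of the Riesz representative of [f] for the inner product weighted by [w ^+ 2]. *)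
pose d i : R[i] := (c i)^*%C * ((w (j - i%:Z) ^+ 2)^-1)%:C%C.
pose x : ell2 w := \sum_(i < n) d i *: delta w (j - i%:Z).
have cc i : c i * (c i)^*%C = (cabs (c i) ^+ 2)%:C%C.
  by rewrite -sqr_normc cabs_norm rmorphXn.
have term i : cabs (c i) ^+ 2 / w (j - i%:Z) ^+ 2 =
    v i ^+ 2 * (s ^+ i / w (j - i%:Z)) ^+ 2.
  by rewrite c_cabs exprMn real_normK ?num_real// expr_div_n; ring.
exists f, x, M; split=> //.
- rewrite M2E rmorph_sum /=; apply: eq_bigr => i _.
  by rewrite /x (sum_delta_coord w d (pinj0 n))// /d mulrA cc -rmorphM term.
- apply/eqP; rewrite -(@eqrXn2 _ 2) ?ell2_norm_ge0 ?(ltW M0)// M2E.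
  rewrite (ell2_norm_sum_delta w d (pinj0 n)); apply/eqP; apply: eq_bigr => i _.
  rewrite /d cabsM cabs_real -term.
  have -> : cabs (c i)^*%C = cabs (c i).
    by apply: (@complexI R); rewrite -!cabs_norm normcJ.
  rewrite ger0_norm ?invr_ge0 ?sqr_ge0//; field.
  by rewrite gt_eqF// wt_gt0.
- move=> a y z; rewrite mulr_sumr -big_split /=; apply: eq_bigr => i _.
  change (c i * (a * y (j - i%:Z) + z (j - i%:Z)) =
    a * (c i * y (j - i%:Z)) + c i * z (j - i%:Z)).
  by ring.
split=> y.
  apply: (ell2_pairing_le y (pinj0 n) (ltW M0)); rewrite M2E; apply: ler_sum => i _.
  by rewrite expr_div_n term.
have -> : f (wshift w y - l *: y) =
    \sum_(i < n) (c i - l * c i.+1) * y (j - (i + 1)%N%:Z).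
  under [RHS]eq_bigr do rewrite addn1.
  rewrite -(sum_diff (fun i => y (j - i%:Z) : R[i]^o)); apply: eq_bigr => i _.
  change (c i * (y (j - i%:Z - 1) - l * y (j - i%:Z)) =
    c i * (y (j - i.+1%:Z) - l * y (j - i%:Z))).
  by rewrite -addn1 PoszD opprD addrA.
apply: (@ell2_pairing_le (fun i => c i - l * c i.+1) _ n (e * M) y (pinj 1%N n)).
  by rewrite mulr_ge0// ltW.
rewrite exprMn M2E (le_trans _ h)//; apply: ler_sum => i _; rewrite addn1.
by rewrite exprMn; exact: c_diff_sqr_le.
Qed.

End NearEigen.

(** * Drops and flat stretches of the weight *)

Section Comparison.
Variable R : realType.
Implicit Types w : weight R.

Lemma ell2_inclusion_exists w1 w2 (K : R) : 0 <= K -> (forall n, w2 n <= K * w1 n) ->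
  exists A : bop w1 w2, forall u n, A u n = u n.
Proof.
move=> K0 hK.
have hle (u : int -> R[i]) : (sqsum w2 u <= (K ^+ 2)%:E * sqsum w1 u)%E.
  apply: esum_le_scale => [|n|n]; first exact: sqr_ge0.
    by rewrite mulr_ge0 ?sqr_ge0.
  rewrite [leRHS]mulrCA; apply: ler_wpM2l; rewrite ?sqr_ge0// -exprMn.
  by rewrite ler_sqr ?nnegrE ?mulr_ge0// ltW// wt_gt0.
have hin (u : ell2 w1) : (u : int -> R[i]) \in ell2_pred w2.
  rewrite ell2P; apply/asboolP; apply: le_lt_trans (hle _) _.
  by rewrite -ell2_norm_sqr -EFinM ltry.
have [||A hA] := @bop_exists _ _ _ (fun u : ell2 w1 => Ell2 (hin u)) K K0.
- by move=> a u v; apply/val_inj.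
- move=> u; apply: ell2_norm_le; first by rewrite mulr_ge0 ?ell2_norm_ge0.
  by rewrite exprMn EFinM ell2_norm_sqr; exact: hle.
by exists A => u n; rewrite hA.
Qed.

Lemma shift_similar_of_comparable w1 w2 (K1 K2 : R) : 0 <= K1 -> 0 <= K2 ->
  (forall n, w2 n <= K1 * w1 n) -> (forall n, w1 n <= K2 * w2 n) ->
  op_similar (wshift w1) (wshift w2).
Proof.
move=> K10 K20 h1 h2.
have [Y hY] := ell2_inclusion_exists K10 h1.
have [Z hZ] := ell2_inclusion_exists K20 h2.
exists Y, Z; split=> u; apply/val_inj/funext => n.
- exact: etrans (hZ _ _) (hY _ _).
- exact: etrans (hY _ _) (hZ _ _).
by apply/esym/(etrans (hY _ _)); exact: hZ.
Qed.

(** Without such a drop the decreasing weight stays between two positive multiples of [w 0]; it is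
    then comparable to the constant weight, and the identity on sequences is a similarity. *)
Lemma contractive_weight_drop w (k : R) : (opnorm (wshift w) <= 1)%E ->
  ~ op_similar (wshift w) (wshift (weight1 R)) -> 0 < k ->
  exists (m : int) (N : nat), w (m + N%:Z) <= k * w m.
Proof.
move=> contr nsim k0; apply: contrapT => h; apply: nsim.
have drop m (N : nat) : k * w m < w (m + N%:Z).
  by rewrite ltNge; apply/negP => hle; apply: h; exists m, N.
have w0 := wt_gt0 w 0.
have lower n : Num.min k 1 * w 0 <= w n.
  have [n0|n0] := leP 0 n.
    rewrite -[n]add0r -(gez0_abs n0).
    rewrite (le_trans _ (ltW (drop 0 `|n|%N)))// ler_wpM2r ?(ltW w0)//.
    by rewrite ge_min lexx.
  apply: (@le_trans _ _ (w 0)).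
    by rewrite ler_piMl ?(ltW w0)// ge_min lexx orbT.
  have -> : 0 = n + `|n|%N%:Z by lia.
  exact: contractive_weight.
have upper n : w n <= (1 + k^-1) * w 0.
  rewrite mulrDl mul1r; have [n0|n0] := leP 0 n.
    rewrite ler_wpDr ?mulr_ge0 ?invr_ge0 ?(ltW k0) ?(ltW w0)//.
    by rewrite -[n]add0r -(gez0_abs n0) contractive_weight.
  rewrite ler_wpDl ?(ltW w0)// ler_pdivlMl//.
  have -> : 0 = n + `|n|%N%:Z by lia.
  exact/ltW/drop.
have c0 : 0 < Num.min k 1 * w 0 by rewrite mulr_gt0// lt_min k0 ltr01.
apply: (@shift_similar_of_comparable _ _ (Num.min k 1 * w 0)^-1 ((1 + k^-1) * w 0)).
- by rewrite invr_ge0 ltW.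
- by rewrite mulr_ge0 ?(ltW w0)// addr_ge0 ?invr_ge0 ?(ltW k0).
- by move=> n; rewrite /= ler_pdivlMl// mulr1.
- by move=> n; rewrite /= mulr1.
Qed.

(** Otherwise the weight at least halves over every [L] steps, and the Neumann argument removes 1
    from the spectrum. *)
Lemma contractive_weight_flat w (L : nat) : (opnorm (wshift w) <= 1)%E ->
  op_spectrum (wshift w) 1 -> exists m : int, w m <= 2 * w (m + L%:Z).
Proof.
move=> contr spec; apply: contrapT => h; apply: spec.
apply: (shift_sub1_invertible contr (L := L)) => n.
rewrite leNgt; apply/negP => hn; apply: h; exists n.
by rewrite mulrC -ler_pdivrMr// ltW.
Qed.

End Comparison.

(** * Lower bounds for the symbol from approximate eigenvectors and eigenfunctionals *)

Section CalculusLowerBound.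
Variables (R : realType) (w : weight R) (Phi : Hinf R -> bop w w) (phi : Hinf R).
Hypothesis hPhi : is_Hinf_calculus (wshift w) Phi.

(** [Q] is [g(S)] for the divided difference [g] of [phi] at [l]. Multiplicativity puts [S - l] on
    either side of [Q]: on the right for eigenvectors, on the left for eigenfunctionals. *)
Lemma calculus_divided_difference (C : R) (l : R[i]) : 0 <= C ->
  (forall f, (opnorm (Phi f) <= (C * supnorm f)%:E)%E) ->
  l != 0 -> unit_disc l ->
  exists Q : bop w w,
  [/\ forall y, ell2_norm (Q y) <= C * (8 * supnorm phi / (1 - cabs l)) * ell2_norm y,
      forall y, Phi phi y = phi l *: y + Q (wshift w y - l *: y) &
      forall y, Phi phi y = phi l *: y + (wshift w (Q y) - l *: Q y)].
Proof.
move=> C0 hC l0 l1; have [g [gE gle]] := hinf_quotient_exists phi l0 l1.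
have [p hp] := hinf_poly_exists ('X - l%:P).
have [one hone] := hinf_poly_exists (1 : {poly R[i]}).
have [h hE] := hinf_lin_exists (- phi l) one phi.
have PhipE u : Phi p u = wshift w u - l *: u.
  rewrite (calc_poly hPhi (p := 'X - l%:P)) => [|z _]; last exact: hp.
  rewrite /poly_op size_XsubC !big_ord_recl big_ord0 addr0 /= /bump /=.
  by rewrite !coefB !coefX !coefC /= sub0r subr0 scaleNr scale1r addrC.
have PhioneE u : Phi one u = u.
  rewrite (calc_poly hPhi (p := 1)) => [|z _]; last exact: hone.
  by rewrite /poly_op size_poly1 big_ord1 /= coefC eqxx scale1r.
have PhiE u : Phi phi u = phi l *: u + Phi h u.
  rewrite (calc_linear hPhi (f := one) (g := phi) (h := h) (a := - phi l)); last by move=> z _.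
  by rewrite PhioneE scaleNr addrA subrr add0r.
have hgp z : unit_disc z -> h z = g z * p z.
  by move=> hz; rewrite hE hone hp !hornerE [RHS]mulrC gE// addrC.
exists (Phi g); split=> y.
- apply: opnorm_leP; rewrite (le_trans (hC g))// lee_fin.
  by rewrite ler_wpM2l.
- by rewrite PhiE (calc_mul hPhi (f := g) (g := p) (h := h))// PhipE.
- rewrite PhiE (calc_mul hPhi (f := p) (g := g) (h := h)) ?PhipE// => z /hgp ->.
  by rewrite mulrC.
Qed.

Variables (B : bop w w) (b C : R).
Hypotheses (b0 : 0 < b) (hb : forall u, ell2_norm (B u) <= b * ell2_norm u).
Hypotheses (FB : cancel (Phi phi) B) (BF : cancel B (Phi phi)).
Hypotheses (C0 : 0 <= C) (hC : forall f, (opnorm (Phi f) <= (C * supnorm f)%:E)%E).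
Variables (l : R[i]) (e : R).
Hypotheses (l0 : l != 0) (l1 : unit_disc l).

Let K := C * (8 * supnorm phi / (1 - cabs l)).

Let K0 : 0 <= K.
Proof.
have : cabs l < 1 by [].
by move=> h; rewrite mulr_ge0// divr_ge0 ?mulr_ge0 ?supnorm_ge0// subr_ge0 ltW.
Qed.

(** Estimate [u = B (phi(S) u)] with [phi(S) u = phi(l) u + Q (S u - l u)]. *)
Lemma symbol_lower_bound_eigenvector (u : ell2 w) : 0 < ell2_norm u ->
  ell2_norm (wshift w u - l *: u) <= e * ell2_norm u ->
  1 <= b * (cabs (phi l) + K * e).
Proof.
move=> u0 hu; have [Q [hQ QE _]] := calculus_divided_difference C0 hC l0 l1.
rewrite -(ler_pM2r u0) mul1r -{1}[u]FB (le_trans (hb _))// -mulrA ler_pM2l//.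
rewrite QE mulrDl; apply: le_trans (ell2_normD _ _) _.
apply: lerD; first exact: ell2_normZ_le.
by apply: le_trans (hQ _) _; rewrite -/K -[leRHS]mulrA ler_wpM2l.
Qed.

(** Write [x = phi(S) y] with [y = B x], so that [||y|| <= b M]. Then
    [M^2 = f x = phi(l) f(y) + f((S - l) Q y)] is at most [M (|phi(l)| + K e) ||y||]. *)
Lemma symbol_lower_bound_eigenfunctional (f : ell2 w -> R[i]) (x : ell2 w) (M : R) :
  0 <= e -> 0 < M -> f x = (M ^+ 2)%:C%C -> ell2_norm x = M ->
  (forall a y z, f (a *: y + z) = a * f y + f z) ->
  (forall y, cabs (f y) <= M * ell2_norm y) ->
  (forall y, cabs (f (wshift w y - l *: y)) <= e * M * ell2_norm y) ->
  1 <= b * (cabs (phi l) + K * e).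
Proof.
move=> e0 M0 fx xM flin fle fSle.
have [Q [hQ _ QE]] := calculus_divided_difference C0 hC l0 l1.
pose y := B x.
have yM : ell2_norm y <= b * M by rewrite -xM hb.
have xE : x = phi l *: y + (wshift w (Q y) - l *: Q y) by rewrite -QE BF.
have : M ^+ 2 <= cabs (phi l) * (M * ell2_norm y) + e * M * (K * ell2_norm y).
  have -> : M ^+ 2 = cabs (f x) by rewrite fx cabs_real ger0_norm ?sqr_ge0.
  rewrite xE flin; apply: le_trans (cabsD _ _) _; rewrite cabsM; apply: lerD.
    by apply: ler_wpM2l (fle y); exact: cabs_ge0.
  apply: le_trans (fSle _) _; apply: ler_wpM2l (hQ y).
  by rewrite mulr_ge0// ltW.
have -> : cabs (phi l) * (M * ell2_norm y) + e * M * (K * ell2_norm y) =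
    M * (cabs (phi l) + K * e) * ell2_norm y by ring.
move=> h; have M20 : 0 < M ^+ 2 by rewrite exprn_gt0.
rewrite -(ler_pM2r M20) mul1r (le_trans h)//.
have -> : b * (cabs (phi l) + K * e) * M ^+ 2 =
    M * (cabs (phi l) + K * e) * (b * M) by ring.
apply: ler_wpM2l yM; apply: mulr_ge0 (ltW M0) _.
exact: addr_ge0 (cabs_ge0 _) (mulr_ge0 K0 e0).
Qed.

End CalculusLowerBound.

(** * From the shape of the weight to a lower bound at one point [l] *)

Section LowerBoundFromWeight.
Variables (R : realType) (w : weight R) (Phi : Hinf R -> bop w w) (phi : Hinf R).
Hypothesis hPhi : is_Hinf_calculus (wshift w) Phi.
Variables (B : bop w w) (b C : R).
Hypotheses (b0 : 0 < b) (hb : forall u, ell2_norm (B u) <= b * ell2_norm u).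
Hypotheses (FB : cancel (Phi phi) B) (BF : cancel B (Phi phi)).
Hypotheses (C0 : 0 <= C) (hC : forall f, (opnorm (Phi f) <= (C * supnorm f)%:E)%E).
Hypothesis contr : (opnorm (wshift w) <= 1)%E.
Variables (l : R[i]) (k : R) (W L N : nat).
Hypotheses (l0 : l != 0) (l1 : unit_disc l).

Let s := (cabs l)^-1.

Hypotheses (W0 : (0 < W)%N) (k0 : 0 < k) (k_small : 2 * k * s ^+ W ^+ 2 <= 1).
Hypotheses (sL : 2 / k <= s ^+ L) (sN : s ^+ N <= 2).

Let s1 : 1 <= s. Proof. by rewrite /s invf_ge1 ?cabs_gt0// ltW. Qed.
Let s0 : 0 < s. Proof. exact: lt_le_trans s1. Qed.

Let bound := 1 <= b * (cabs (phi l) + C * (8 * supnorm phi / (1 - cabs l)) * W%:R^-1).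

(** For [G i = s ^+ i * w (j + i)]: on the flat stretch [s ^+ L >= 2 / k] outweighs the factor 2
    lost by [w], so [G] gains [1 / k]. Along the drop [s ^+ N <= 2] spoils the factor [k / 2] only
    to [k]. Thus [G] has humps at [L] and [L + a]. *)
Lemma lower_bound_flat_then_drop (j : int) (a : nat) :
  w j <= 2 * w (j + L%:Z) ->
  w (j + (L + a + N)%N%:Z) <= k / 2 * w (j + (L + a)%N%:Z) -> bound.
Proof.
move=> flat drop.
pose G i := s ^+ i * w (j + i%:Z).
have G0 i : 0 < G i by rewrite mulr_gt0 ?exprn_gt0 ?wt_gt0.
have GS i : G i.+1 <= s * G i.
  rewrite /G exprS mulrA ler_wpM2l ?mulr_ge0 ?exprn_ge0 ?(ltW s0)//.
  by rewrite -addn1 PoszD addrA contractive_weight_succ.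
have h1 : G 0 <= k * G L.
  rewrite /G expr0 mul1r addr0 (le_trans flat)// mulrA ler_wpM2r ?(ltW (wt_gt0 _ _))//.
  by rewrite mulrC -ler_pdivrMr.
have h2 : G (L + a + N)%N <= k * G (L + a)%N.
  rewrite /G exprD -mulrA [leRHS]mulrCA ler_wpM2l ?exprn_ge0 ?(ltW s0)//.
  have := ler_wpM2l (exprn_ge0 N (ltW s0)) drop => /le_trans; apply.
  rewrite mulrA ler_wpM2r ?(ltW (wt_gt0 _ _))//.
  by rewrite mulrCA ger_pMr// ler_pdivrMr// mul1r.
have Lr : (L <= L + a + N)%N by rewrite -addnA leq_addr.
have [n [v [v0 vn vpos hv]]] := trapezoid_of_two_humps G0 GS s1 W0 (ltW k0) k_small
  h1 h2 Lr (leq_addr N (L + a)).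
have e0 : 0 <= (W%:R : R)^-1 by rewrite invr_ge0.
have [u [uE hu]] := near_eigenvector_exists l0 (ltW l1) e0 v0 vn hv.
apply: (symbol_lower_bound_eigenvector hPhi b0 hb FB C0 hC l0 l1 (u := u)) => //.
rewrite lt0r ell2_norm_ge0 andbT; apply: contraTneq vpos => u0.
by rewrite -uE u0 expr0n ltxx.
Qed.

(** The mirror image: read leftwards from [j], the reciprocal weight decreases, first along the flat
    stretch and then by the factor [k / 2], so [s ^+ i / w (j - i)] has the two humps. *)
Lemma lower_bound_drop_then_flat (j : int) (a : nat) :
  w (j - L%:Z) <= 2 * w j ->
  w (j - (L + a)%N%:Z) <= k / 2 * w (j - (L + a + N)%N%:Z) -> bound.
Proof.
move=> flat drop.
pose G i := s ^+ i / w (j - i%:Z).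
have wp i := wt_gt0 w i.
have G0 i : 0 < G i by rewrite divr_gt0 ?exprn_gt0.
have GS i : G i.+1 <= s * G i.
  rewrite /G exprS mulrA ler_wpM2l ?mulr_ge0 ?exprn_ge0 ?(ltW s0)//.
  rewrite lef_pV2 ?posrE//.
  have -> : j - i%:Z = j - i.+1%:Z + 1 by rewrite -addn1 PoszD opprD addrA subrK.
  exact: contractive_weight_succ.
have h1 : G 0 <= k * G L.
  rewrite /G expr0 mul1r subr0 mulrA ler_pdivlMr// ler_pdivrMl//.
  apply: le_trans flat _; rewrite mulrC; apply: ler_wpM2l; first exact: ltW.
  by rewrite mulrC -ler_pdivrMr.
have h2 : G (L + a + N)%N <= k * G (L + a)%N.
  rewrite /G exprD -mulrA [leRHS]mulrCA ler_wpM2l ?exprn_ge0 ?(ltW s0)//.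
  rewrite ler_pdivrMr// mulrAC ler_pdivlMr//.
  have := ler_wpM2l (exprn_ge0 N (ltW s0)) drop => /le_trans; apply.
  rewrite mulrA ler_wpM2r ?(ltW (wp _))//.
  by rewrite mulrCA ger_pMr// ler_pdivrMr// mul1r.
have Lr : (L <= L + a + N)%N by rewrite -addnA leq_addr.
have [n [v [v0 vn vpos hv]]] := trapezoid_of_two_humps G0 GS s1 W0 (ltW k0) k_small
  h1 h2 Lr (leq_addr N (L + a)).
have e0 : 0 <= (W%:R : R)^-1 by rewrite invr_ge0.
have [f [x [M [M0 fx xM flin [fle fSle]]]]] :=
  near_eigenfunctional_exists l0 (ltW l1) e0 v0 vn vpos hv.
exact: (symbol_lower_bound_eigenfunctional hPhi hb BF C0 hC l0 l1 e0 M0 fx xM).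
Qed.

(** The flat stretch has length [L + N + L] so that a drop of length [N], wherever it lies, leaves
    [L] flat steps free. If it starts at [m' + L] or later, the first [L] steps precede it;
    otherwise it ends before [m' + L + N], and the last [L] steps follow it. *)
Lemma lower_bound_flat_and_drop (m m' : int) :
  w m' <= 2 * w (m' + (L + N + L)%N%:Z) -> w (m + N%:Z) <= k / 2 * w m -> bound.
Proof.
move=> flat drop.
have wle (p q : int) : p <= q -> w q <= w p.
  move=> pq; have -> : q = p + (absz (q - p))%:Z by move: pq; clear; lia.
  exact: contractive_weight.
have [h|h] := leP (m' + L%:Z) m.
  have [a aE] : exists a : nat, m = m' + (L + a)%N%:Z.
    by exists (absz (m - m' - L%:Z)%R); move: h; clear; lia.
  apply: (@lower_bound_flat_then_drop m' a).
    by apply: le_trans flat _; apply: ler_wpM2l => //; apply: wle; clear; lia.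
  by rewrite PoszD addrA -aE.
have [a aE] : exists a : nat, m = m' + (L + N + L)%N%:Z - (L + a + N)%N%:Z.
  by exists (absz (m' + L%:Z - m)%R); move: h; clear; lia.
apply: (@lower_bound_drop_then_flat (m' + (L + N + L)%N%:Z) a).
  by apply: le_trans flat; apply: wle; clear; lia.
by rewrite -aE (le_trans _ drop)// aE wle//; clear; lia.
Qed.

End LowerBoundFromWeight.

(** * Lower bound near the circle, and conclusion *)

Lemma bernoulli_le (R : realType) (t : R) n : 0 <= t <= 1 -> 1 - n%:R * t <= (1 - t) ^+ n.
Proof.
move=> /andP[t0 t1]; elim: n => [|n ih]; first by rewrite mul0r subr0.
have t2 : 0 <= 1 - t by rewrite subr_ge0.
have := ler_wpM2l t2 ih; rewrite exprS => /(le_trans _); apply.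
rewrite -natr1; have : 0 <= n%:R * t * t by rewrite !mulr_ge0.
by move: (n%:R : R) => x; lra.
Qed.

Lemma liminf_circle_ge (R : realType) (f : R[i] -> R[i]) (d r : R) : r < 1 ->
  (forall z, r < cabs z < 1 -> d <= cabs (f z)) -> (d%:E <= liminf_circle f)%E.
Proof.
move=> r1 hd; rewrite /liminf_circle limf_einfE; apply: ereal_sup_ge.
exists (ereal_inf ((fun z => (cabs (f z))%:E) @` [set z | r < cabs z < 1])).
  by exists [set z | r < cabs z < 1] => //; exists r.
by apply: le_ereal_inf_tmp => _ [z /= hz <-]; rewrite lee_fin hd.
Qed.

(** The order of the choices matters: [D], [k], the drop with its length [N], and the radius
    [1 - t0] are fixed before [l]. Only [q], [W], [L] and the flat stretch depend on [l], so the
    bound is uniform. *)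
Lemma symbol_bounded_below_near_circle (R : realType) (w : weight R)
    (Phi : Hinf R -> bop w w) (phi : Hinf R) :
  is_Hinf_calculus (wshift w) Phi -> (opnorm (wshift w) <= 1)%E ->
  op_spectrum (wshift w) 1 -> ~ op_similar (wshift w) (wshift (weight1 R)) ->
  op_invertible (Phi phi) ->
  exists d r : R, [/\ 0 < d, r < 1 & forall z, r < cabs z < 1 -> d <= cabs (phi z)].
Proof.
move=> hPhi contr spec nsim [B [FB BF]].
have [b b0 hb] := bop_bound B.
have [C C0 hC] : exists2 C : R, 0 <= C &
    forall f, (opnorm (Phi f) <= (C * supnorm f)%:E)%E.
  have [C hC] := calc_bounded hPhi; exists (Num.max C 0); first by rewrite le_max lexx orbT.
  move=> f; rewrite (le_trans (hC f))// lee_fin ler_wpM2r ?supnorm_ge0//.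
  by rewrite le_max lexx.
(* With [W t >= D / 4] the error [C * (8 * supnorm phi / t) / W] is at most
   [32 * C * supnorm phi / D]. This is at most [1 / (2 b)], half of the available [1 / b], once
   [D >= X]. *)
pose X := 64 * b * C * supnorm phi.
have X0 : 0 <= X by rewrite !mulr_ge0 ?supnorm_ge0// ltW.
pose D := (Num.truncn X).+1.
have XD : X < D%:R by exact: truncnS_gt.
have D0 : 0 < D%:R :> R by rewrite ltr0n.
(* Chosen so that [2 * k * (2 ^+ D) ^+ 2 = 1], where [2 ^+ D] will bound [s ^+ W]. *)
pose k : R := 2^-1 ^+ (2 * D).+1.
have k0 : 0 < k by rewrite exprn_gt0 ?invr_gt0.
have [m [N drop]] : exists (m : int) (N : nat), w (m + N%:Z) <= k / 2 * w m.
  by apply: contractive_weight_drop => //; rewrite divr_gt0.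
(* For [t < t0] this gives [N t <= 1/4], hence [s ^+ N <= 2] by Bernoulli's inequality; [N.+1]
   covers [N = 0] and yields [t0 <= 1/4]. *)
pose t0 : R := (4 * N.+1%:R)^-1.
have t00 : 0 < t0 by rewrite invr_gt0 mulr_gt0.
have t04 : t0 <= 4^-1.
  by rewrite lef_pV2 ?posrE ?mulr_gt0// ler_peMr// ler1n.
exists (2 * b)^-1, (1 - t0); split=> [||l /andP[lt0 l1]].
- by rewrite invr_gt0 mulr_gt0.
- by rewrite ltrBlDr ltrDl.
pose t := 1 - cabs l.
have tp : 0 < t by rewrite subr_gt0.
have tt0 : t < t0 by rewrite /t; lra.
have t4 : t < 4^-1 by exact: lt_le_trans t04.
have lE : cabs l = 1 - t by rewrite /t; ring.
have lp : 0 < cabs l by lra.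
have l0 : l != 0 by rewrite -cabs_gt0.
pose s := (cabs l)^-1.
have s0 : 0 < s by rewrite invr_gt0.
have pow_le n : n%:R * t <= 2^-1 -> s ^+ n <= 2.
  move=> nt; rewrite /s exprVn -[2]invrK lef_pV2 ?posrE ?invr_gt0 ?exprn_gt0//.
  rewrite lE (le_trans _ (bernoulli_le _ _))//; first by lra.
  by apply/andP; split; lra.
have sN : s ^+ N <= 2.
  apply: pow_le; have : N%:R * t <= N.+1%:R * t0.
    by apply: ler_pM; rewrite ?ler_nat// ltW.
  move/le_trans; apply; rewrite /t0 invfM mulrCA mulfV ?mulr1; last by rewrite gt_eqF.
  by lra.
(* [q t] lies in [[1/4, 1/2]], so that [W = D q] satisfies [s ^+ W <= 2 ^+ D] and
   [1 / (W t) <= 4 / D]. *)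
pose q := Num.truncn (2 * t)^-1.
have t20 : 0 < (2 * t)^-1 by rewrite invr_gt0 mulr_gt0.
have qle : q%:R * t <= 2^-1.
  have : q%:R <= (2 * t)^-1 by rewrite truncn_le ltW.
  by move=> h; have := ler_wpM2r (ltW tp) h; rewrite invfM mulfVK ?gt_eqF.
have qge : 4^-1 <= q%:R * t.
  have : (2 * t)^-1 * t < q.+1%:R * t by rewrite ltr_pM2r// truncnS_gt.
  by rewrite invfM mulfVK ?gt_eqF// -(natr1 q) mulrDl mul1r => h1; lra.
have q0 : (0 < q)%N.
  by rewrite lt0n; apply/eqP => qq; move: qge; rewrite qq mul0r leNgt invr_gt0 ltr0n.
pose W := (D * q)%N.
have W0 : (0 < W)%N by rewrite muln_gt0.
have sW : s ^+ W <= 2 ^+ D.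
  by rewrite /W mulnC exprM lerXn2r ?nnegrE ?exprn_ge0 ?(ltW s0)// pow_le.
have k_small : 2 * k * s ^+ W ^+ 2 <= 1.
  have : s ^+ W ^+ 2 <= 2 ^+ D ^+ 2 by rewrite lerXn2r ?nnegrE ?exprn_ge0 ?(ltW s0).
  have k20 : 0 <= 2 * k by rewrite mulr_ge0// ltW.
  move/(ler_wpM2l k20)/le_trans; apply.
  have -> : 2 * k = 2^-1 ^+ (2 * D) by rewrite /k exprS mulVKf.
  by rewrite -exprM [(D * 2)%N]mulnC -exprMn mulVf// expr1n.
have [L sL] : exists L, 2 / k <= s ^+ L.
  have l01 : 0 <= cabs l < 1 by rewrite (ltW lp).
  have [L hL] := geometric_lt (2 / k) l01 ltr01; exists L.
  by rewrite /s exprVn -[leRHS]div1r ler_pdivlMr ?exprn_gt0// ltW// hL.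
have [m' flat] := contractive_weight_flat (L + N + L) contr spec.
have := lower_bound_flat_and_drop hPhi b0 hb FB BF C0 hC contr l0 l1 W0 k0 k_small sL sN flat drop.
rewrite -/t => hbound.
have small : C * (8 * supnorm phi / t) / W%:R <= (2 * b)^-1.
  have tq : 0 < 4 * (t * q%:R) by rewrite !mulr_gt0// ltr0n.
  have -> : C * (8 * supnorm phi / t) / W%:R = X / D%:R / (2 * b) / (4 * (t * q%:R)).
    by rewrite /X /W natrM; field; rewrite !gt_eqF// ltr0n.
  rewrite ler_pdivrMr//.
  apply: (@le_trans _ _ (2 * b)^-1).
    rewrite ler_piMl ?invr_ge0 ?mulr_ge0 ?(ltW b0)//.
    by rewrite ler_pdivrMr// mul1r ltW.
  rewrite ler_peMr ?invr_ge0 ?mulr_ge0 ?(ltW b0)//.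
  by lra.
have {hbound} : b^-1 <= cabs (phi l) + C * (8 * supnorm phi / t) / W%:R.
  by rewrite -[leLHS]mulr1 ler_pdivrMl.
have -> : b^-1 = (2 * b)^-1 + (2 * b)^-1 by field; rewrite gt_eqF.
by lra.
Qed.

Theorem theorem4p3 (R : realType) (w : weight R) (phi : Hinf R)
    (A : bop w w)
    (hpb : op_power_bounded (wshift w))
    (hsp : subset (@unit_circle R) (op_spectrum (wshift w)))
    (hphi : liminf_circle phi = 0%E)
    (hA : is_shift_calculus phi A)
    (hinv : op_invertible A) :
  op_similar (wshift w) (wshift (weight1 R)).
Proof.
have [w' [Y [Z [Phi [contr simS hPhi simA]]]]] := hA.
have [YZ ZY SE] := simS; have [_ _ AE] := simA.
have sim : op_similar (wshift w') (wshift w) by exists Y, Z.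
(* It suffices to treat the contractive shift with weight [w'], on which the calculus [Phi] lives;
   spectrum and invertibility are carried there by [Y] and [Z]. *)
apply: (op_similar_trans (op_similar_sym sim)).
apply: contrapT => nsim.
have spec : op_spectrum (wshift w') 1.
  have : op_spectrum (wshift w) 1.
    by apply: hsp; have : cabs (1 : R[i]) = 1 by exact: Normc.normc1.
  apply: contra_not => hi; apply: (op_invertible_similar YZ ZY _ hi) => v.
  by rewrite SE !scale1r linearB ZY.
have inv : op_invertible (Phi phi).
  apply: (op_invertible_similar ZY YZ _ hinv) => v.
  by rewrite AE !YZ.
have [d [r [d0 r1 hd]]] := symbol_bounded_below_near_circle hPhi contr spec nsim inv.
have := liminf_circle_ge r1 hd; rewrite hphi lee_fin.
by rewrite leNgt d0.
Qed.
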